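(* Let $\alpha=\tfrac12(\sqrt5-1)$ and $\theta\in[0,1)$, and let $J$ be the half-line Jacobi matrix with $a_n=1$ and $b_n=\chi_{[1-\alpha,1)}\big((n\alpha+\theta)\bmod 1\big)$ for $n\ge1$ (a Fibonacci model restricted to a half-line). Then $\sup_{x_0\in\sigma(J)}p_n(x_0)^2/K_n(x_0,x_0)\to0$ as $n\to\infty$; i.e. the Nevai condition holds uniformly on the spectrum of $J$.
   Context: $\chi_I$ denotes the characteristic function of $I$. The half-line Jacobi matrix $J$ acts on $\ell^2(\{1,2,\dots\})$ by $J_{nn}=b_n$, $J_{n,n+1}=J_{n+1,n}=a_n$; $\rho$ is its spectral measure for $\delta_1$, $p_n$ its orthonormal polynomials ($p_{-1}=0$, $p_0=1$, $xp_n=a_{n+1}p_{n+1}+b_{n+1}p_n+a_np_{n-1}$), and $K_n(x,y)=\sum_{j=0}^np_j(x)p_j(y)$. The Nevai condition at $x_0$ means $K_n(x,x_0)^2d\rho(x)/K_n(x_0,x_0)\to\delta_{x_0}$ weakly. *)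

(* Defs.v *)
From Stdlib Require Import Reals Lra.
Open Scope R_scope.

Definition alpha : R := (sqrt 5 - 1) / 2.

Definition fib_b (theta : R) (n : nat) : R :=
  let t := frac_part (INR n * alpha + theta) in
  if Rle_dec (1 - alpha) t then (if Rlt_dec t 1 then 1 else 0) else 0.

(* Jacobi parameters a_n = 1, b_n = b n (n >= 1).
   Orthonormal polynomials: p_{-1} = 0, p_0 = 1,
   x p_n = a_{n+1} p_{n+1} + b_{n+1} p_n + a_n p_{n-1}, i.e. with a = 1
   p_{n+1}(x) = (x - b_{n+1}) p_n(x) - p_{n-1}(x).
   jac_pair b n x = (p_n(x), p_{n-1}(x)). *)
Fixpoint jac_pair (b : nat -> R) (n : nat) (x : R) : R * R :=
  match n with
  | O => (1, 0)
  | S m => let (pm, pm1) := jac_pair b m x in ((x - b (S m)) * pm - pm1, pm)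
  end.

Definition jac_p (b : nat -> R) (n : nat) (x : R) : R := fst (jac_pair b n x).

Definition jac_K (b : nat -> R) (n : nat) (x y : R) : R :=
  sum_f_R0 (fun j => jac_p b j x * jac_p b j y) n.

(* Vectors in l^2({1,2,...}) are represented by u : nat -> R with u k = u_{k+1}. *)
Definition sqnorm_is (u : nat -> R) (l : R) : Prop :=
  infinite_sum (fun k => (u k) ^ 2) l.

Definition in_l2 (u : nat -> R) : Prop := exists l, sqnorm_is u l.

(* Action of the half-line Jacobi matrix with a_n = 1, J_nn = b_n:
   (Ju)_1 = b_1 u_1 + u_2,  (Ju)_n = u_{n-1} + b_n u_n + u_{n+1} (n >= 2). *)
Definition jac_apply (b : nat -> R) (u : nat -> R) (k : nat) : R :=
  match k with
  | O => b 1%nat * u O + u 1%nat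
  | S j => u j + b (S (S j)) * u (S j) + u (S (S j))
  end.

(* x is in the resolvent set iff J - x : l^2 -> l^2 has a bounded inverse:
   it is onto l^2 and bounded below. *)
Definition in_resolvent (b : nat -> R) (x : R) : Prop :=
  (forall v, in_l2 v -> exists u, in_l2 u /\ (forall k, jac_apply b u k - x * u k = v k))
  /\ exists C : R, forall u lu lv, in_l2 u -> sqnorm_is u lu ->
       sqnorm_is (fun k => jac_apply b u k - x * u k) lv -> lu <= C * lv.

(* (real) spectrum of J; J is self-adjoint so sigma(J) is a subset of R *)
Definition in_spectrum (b : nat -> R) (x : R) : Prop := ~ in_resolvent b x.

(* Main.v *)
Require Import Defs.
From Stdlib Require Import Reals Lra Lia ZArith Psatz Classical ClassicalEpsilon.
From Coquelicot Require Import Coquelicot.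
Open Scope R_scope.

(** Let [U n = (p_n, p_{n-1})].  A word of period [m] on [(n - 2m, n]] gives, by
    Cayley-Hamilton, [U n = t U (n-m) - U (n-2m)], where [t] is the trace of the
    transfer matrix over one period.  In a Fibonacci sequence every position ends such
    a square at one of any four consecutive scales, [m] being a Fibonacci number and
    [t] the trace [x_k] of the trace map.  If [x_0, ..., x_K] are bounded by 200, this
    yields of the order of [K] distinct [j < n] with [|U j| >= |U n| / 201], whence
    [p_n^2 / K_n = O(1/K)].

    If some [|x_k|] exceeds 200, the invariant of the trace map forces all traces from
    level [K + 2] on to be at least 200 in absolute value.  Every position is, up to a
    shift to [n' = n] or [n' = n+1], the centre of a square at one of any two
    consecutive scales, so that [|U n| <= (6/200) (|U (n'-m)| + |U (n'+m)|)]: the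
    maxima of [|U|] over blocks of a fixed length either decay geometrically from the
    start, at a rate independent of the energy, or grow exponentially.  In the second
    case the same estimate with a source term shows that [J - x] is bounded below on l^2, and a Neumann series for
    [I - s (J - x)^2] shows that [x] is in the resolvent set. *)

(** * Sturmian sequences and their block hierarchy *)

(** The supremum over the spectrum makes uniformity in the energy the real issue. The dichotomy is
    applied at a fixed level [K] to each energy separately, and both resulting bounds depend on [K]
    alone, so the spectrum never has to be described by bounded trace orbits. Energies with escaping
    traces cannot be dismissed: a half-line matrix may have eigenvalues in the gaps of the
    whole-line model. At those [p_n] decays, and since [p_0 = 1] gives [K_n >= 1], a decay rate
    depending only on [K] is enough. The growth alternative has only to place [x] in the resolvent
    set, so its constants may depend on [x]. The letters are coded on all of [Z], although the
    matrix lives on a half-line: every block then has neighbours on both sides at every level, and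
    the origin enters only through the requirement that a square lie to its right. The threshold 200
    meets two demands: the invariant must exclude a larger trace between two small ones, and [6/200]
    must be small enough for a three-term inequality to separate decay from growth. *)

Lemma alpha_sqr : alpha * alpha = 1 - alpha.
Proof. unfold alpha. assert (H := sqrt_sqrt 5 ltac:(lra)). nra. Qed.

Lemma alpha_bounds : 1/2 < alpha < 7/10.
Proof.
  unfold alpha. assert (H := sqrt_sqrt 5 ltac:(lra)).
  assert (H0 := sqrt_pos 5). split; nra.
Qed.

(* The non-strict bounds on both sides make this class, unlike the codings by
   integer parts, stable under renormalisation. *)
Definition sturmian (f : Z -> Z) : Prop :=
  exists t : R, forall n : Z,
    t + IZR n * alpha - 1 <= IZR (f n) <= t + IZR n * alpha.

Lemma sturmian_step (f : Z -> Z) : sturmian f ->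
  forall n, f (n + 1)%Z = f n \/ f (n + 1)%Z = (f n + 1)%Z.
Proof.
  intros [t Ht] n. assert (H1 := Ht n). assert (H2 := Ht (n + 1)%Z).
  rewrite plus_IZR in H2. assert (A := alpha_bounds).
  assert (L : (f n - 1 < f (n + 1))%Z) by (apply lt_IZR; rewrite minus_IZR; lra).
  assert (M : (f (n + 1) < f n + 2)%Z) by (apply lt_IZR; rewrite plus_IZR; lra).
  lia.
Qed.

Lemma sturmian_step2 (f : Z -> Z) : sturmian f -> forall n, (f n < f (n + 2))%Z.
Proof.
  intros [t Ht] n. assert (H1 := Ht n). assert (H2 := Ht (n + 2)%Z).
  rewrite plus_IZR in H2. assert (A := alpha_bounds). apply lt_IZR; lra.
Qed.

Lemma sturmian_mono (f : Z -> Z) : sturmian f -> forall n m, (n <= m)%Z -> (f n <= f m)%Z.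
Proof.
  intros Hf n m H. replace m with (n + Z.of_nat (Z.to_nat (m - n)))%Z by lia.
  induction (Z.to_nat (m - n)) as [|d IH].
  - replace (n + Z.of_nat 0)%Z with n by lia. lia.
  - replace (n + Z.of_nat (S d))%Z with (n + Z.of_nat d + 1)%Z by lia.
    destruct (sturmian_step f Hf (n + Z.of_nat d)%Z); lia.
Qed.

(** [g i] is the position where [f] jumps to [i]. Its slope is [1 / alpha = 1 + alpha], so
    subtracting [i] restores the slope [alpha]: the golden mean is a fixed point of this
    renormalisation. Gaps 1 and 2 of [g] become increments 0 and 1. *)
Lemma sturmian_renorm (f : Z -> Z) : sturmian f ->
  { g : Z -> Z | (forall i n, (g i <= n)%Z <-> (i <= f n)%Z)
                 /\ sturmian (fun i => g i - i - 1)%Z }.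
Proof.
  intros Hf. apply constructive_indefinite_description.
  assert (Hmono := sturmian_mono f Hf).
  destruct Hf as [t Ht]. assert (A := alpha_bounds). assert (Q := alpha_sqr).
  (* As [1 + alpha = 1 / alpha], the line [t + n alpha] reaches [i] at [(i - t) (1 + alpha)]. The
     closed bounds leave two candidates for the least [n] with [i <= f n], namely [z i - 1] and
     [z i]. *)
  pose (z := fun i : Z => up ((IZR i - t) * (1 + alpha))).
  exists (fun i => if Z_le_dec i (f (z i - 1)%Z) then (z i - 1)%Z else z i).
  assert (Hz : forall i, (i <= f (z i))%Z /\ (f (z i - 2) < i)%Z).
  { intro i. destruct (archimed ((IZR i - t) * (1 + alpha))) as [U1 U2].
    fold (z i) in U1, U2.
    assert (E : (IZR i - t) * (1 + alpha) * alpha = IZR i - t)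
      by (replace (IZR i - t) with ((IZR i - t) * (alpha + alpha * alpha)) at 2
            by (rewrite Q; ring); ring).
    set (y := (IZR i - t) * (1 + alpha)) in *. split.
    - assert (L : (i - 1 < f (z i))%Z).
      { apply lt_IZR. rewrite minus_IZR. assert (H := Ht (z i)). nra. }
      lia.
    - apply lt_IZR. assert (H := Ht (z i - 2)%Z). rewrite minus_IZR in H. nra. }
  assert (G : forall i n,
    ((if Z_le_dec i (f (z i - 1)%Z) then (z i - 1)%Z else z i) <= n)%Z
    <-> (i <= f n)%Z).
  { intros i n. destruct (Hz i) as [Z1 Z2].
    destruct (Z_le_dec i (f (z i - 1)%Z)) as [l|l]; split; intro H.
    - assert (H' := Hmono _ _ H). lia.
    - destruct (Z_le_gt_dec (z i - 1) n) as [|N]; trivial.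
      assert (H' := Hmono n (z i - 2)%Z ltac:(lia)). lia.
    - assert (H' := Hmono _ _ H). lia.
    - destruct (Z_le_gt_dec (z i) n) as [|N]; trivial.
      assert (H' := Hmono n (z i - 1)%Z ltac:(lia)). lia. }
  split; [exact G|].
  exists (- t * (1 + alpha)). intro i. cbv beta.
  set (gi := if Z_le_dec i (f (z i - 1)%Z) then (z i - 1)%Z else z i).
  assert (G1 : (i <= f gi)%Z) by (apply G; lia).
  assert (G2 : (f (gi - 1) < i)%Z).
  { destruct (Z_lt_ge_dec (f (gi - 1)%Z) i) as [|N]; trivial.
    assert (H : (gi <= gi - 1)%Z) by (apply (proj2 (G i (gi - 1)%Z)); lia). lia. }
  apply IZR_le in G1. apply Z.lt_le_pred, IZR_le in G2.
  unfold Z.pred in G2. rewrite plus_IZR in G2.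
  assert (H1 := Ht gi). assert (H2 := Ht (gi - 1)%Z). rewrite minus_IZR in H2.
  rewrite !minus_IZR.
  assert (B1 : (IZR i - t) * 1 <= IZR gi * alpha) by lra.
  assert (B2 : IZR gi * alpha <= (IZR i - t) + alpha) by lra.
  assert (E : IZR gi * alpha * (1 + alpha) = IZR gi).
  { replace (IZR gi * alpha * (1 + alpha)) with (IZR gi * (alpha + alpha * alpha)) by ring.
    rewrite Q. ring. }
  assert (C1 : (IZR i - t) * 1 * (1 + alpha) <= IZR gi * alpha * (1 + alpha))
    by (apply Rmult_le_compat_r; lra).
  assert (C2 : IZR gi * alpha * (1 + alpha) <= ((IZR i - t) + alpha) * (1 + alpha))
    by (apply Rmult_le_compat_r; lra).
  rewrite E in C1, C2.
  assert (D : (IZR i - t + alpha) * (1 + alpha) = (IZR i - t) * (1 + alpha) + 1)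
    by (replace 1 with (alpha + alpha * alpha) at 3 by lra; ring).
  lra.
Qed.

(* Two-sided sequence [c] cut, at every level [k], into long and short blocks:
   block [i] of level [k] consists of the letters in [(bd k i, bd k (i+1)]] and is
   long iff [tp k i].  A long block of level [k+1] is a short one followed by a long
   one of level [k]; a short block of level [k+1] is a long one of level [k]. *)
Record hierarchy (c : Z -> R) : Type := Hierarchy {
  tp : nat -> Z -> bool;
  bd : nat -> Z -> Z;
  rt : nat -> Z -> Z;
  bd_0 : forall i, bd 0 i = i;
  tp_0 : forall i, c (i + 1)%Z = if tp 0 i then 1 else 0;
  bd_S : forall k i, bd (S k) i = bd k (rt k i);
  tp_long : forall k i, tp (S k) i = true ->
    tp k (rt k i) = false /\ tp k (rt k i + 1)%Z = true
    /\ rt k (i + 1)%Z = (rt k i + 2)%Z;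
  tp_short : forall k i, tp (S k) i = false ->
    tp k (rt k i) = true /\ rt k (i + 1)%Z = (rt k i + 1)%Z;
  rt_cover : forall k n, exists i, (rt k i <= n < rt k (i + 1))%Z;
  short_isolated : forall k i, tp k i = false -> tp k (i + 1)%Z = true }.

Arguments tp {c}. Arguments bd {c}. Arguments rt {c}.

Fixpoint renorm (s : {f : Z -> Z | sturmian f}) (k : nat) : {f : Z -> Z | sturmian f} :=
  match k with
  | O => s
  | S j =>
      let r := renorm s j in
      let g := sturmian_renorm (proj1_sig r) (proj2_sig r) in
      exist _ (fun i => proj1_sig g i - i - 1)%Z (proj2 (proj2_sig g))
  end.

Lemma sturmian_hierarchy (f : Z -> Z) : sturmian f ->
  hierarchy (fun n => IZR (f n - f (n - 1))%Z).
Proof.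
  intro Hf. pose (s := exist _ f Hf : {f : Z -> Z | sturmian f}).
  pose (F := fun k => proj1_sig (renorm s k)).
  pose (SF := fun k => proj2_sig (renorm s k) : sturmian (F k)).
  pose (g := fun k => proj1_sig (sturmian_renorm (F k) (SF k))).
  assert (FS : forall k i, F (S k) i = (g k i - i - 1)%Z) by reflexivity.
  assert (G : forall k i n, (g k i <= n)%Z <-> (i <= F k n)%Z).
  { intros k. exact (proj1 (proj2_sig (sturmian_renorm (F k) (SF k)))). }
  assert (F0 : forall i, F 0%nat i = f i) by reflexivity.
  clearbody g. clearbody SF F.
  assert (Fg : forall k i, F k (g k i) = i /\ F k (g k i - 1)%Z = (i - 1)%Z).
  { intros k i. assert (G1 : (i <= F k (g k i))%Z) by (apply G; lia).
    assert (G2 : (F k (g k i - 1) < i)%Z).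
    { destruct (Z_lt_ge_dec (F k (g k i - 1)%Z) i) as [|N]; trivial.
      assert (H : (g k i <= g k i - 1)%Z) by (apply G; lia). lia. }
    destruct (sturmian_step _ (SF k) (g k i - 1)%Z) as [H|H];
      replace (g k i - 1 + 1)%Z with (g k i) in H by lia; lia. }
  (* A block is long iff [F k] jumps across it. Block [g k (i + 1) - 1] carries the jump to [i + 1],
     so a block of the next level starts just after one jump and ends with the next. *)
  refine (@Hierarchy _ (fun k i => Z.ltb (F k i) (F k (i + 1)%Z))
    (fun k => (fix E k i := match k with O => i | S j => E j (g j i) end) k) g
    _ _ _ _ _ _ _); try reflexivity.
  - intro i. cbv beta. rewrite !F0. replace (i + 1 - 1)%Z with i by lia.
    destruct (sturmian_step f Hf i) as [H|H]; rewrite H.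
    + rewrite Z.sub_diag, Z.ltb_irrefl. reflexivity.
    + replace (f i <? f i + 1)%Z with true by (symmetry; apply Z.ltb_lt; lia).
      f_equal; lia.
  - intros k i H. apply Z.ltb_lt in H. rewrite !FS in H.
    destruct (Fg k i) as [A1 A2]. destruct (Fg k (i + 1)%Z) as [B1 B2].
    assert (M := sturmian_mono _ (SF k)).
    assert (E : g k (i + 1)%Z = (g k i + 2)%Z).
    { assert (S2 := sturmian_step2 _ (SF k) (g k i)).
      assert (L : (g k (i + 1) <= g k i + 2)%Z) by (apply G; lia). lia. }
    rewrite E in *. replace (g k i + 2 - 1)%Z with (g k i + 1)%Z in B2 by lia.
    replace (g k i + 1 + 1)%Z with (g k i + 2)%Z by lia.
    rewrite Z.ltb_ge, Z.ltb_lt. lia.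
  - intros k i H. apply Z.ltb_ge in H. rewrite !FS in H.
    destruct (Fg k i) as [A1 A2]. destruct (Fg k (i + 1)%Z) as [B1 B2].
    assert (M := sturmian_mono _ (SF k)).
    assert (E : g k (i + 1)%Z = (g k i + 1)%Z).
    { destruct (Z_le_gt_dec (g k (i + 1)%Z) (g k i)) as [L|L]; [|lia].
      assert (M' := M _ _ L). lia. }
    rewrite E in *. rewrite Z.ltb_lt. lia.
  - intros k n. exists (F k n). split; [apply G; lia|].
    destruct (Z_lt_ge_dec n (g k (F k n + 1)%Z)) as [|N]; trivial.
    assert (H : (F k n + 1 <= F k n)%Z) by (apply G; lia). lia.
  - intros k i H. apply Z.ltb_ge in H. apply Z.ltb_lt.
    assert (S2 := sturmian_step2 _ (SF k) i).
    replace (i + 1 + 1)%Z with (i + 2)%Z by lia. lia.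
Qed.

(** * The Fibonacci potential as a Sturmian sequence *)

Definition fib_floor (theta : R) (n : Z) : Z := Int_part (IZR (n + 1) * alpha + theta).

Definition fib_letter (theta : R) (n : Z) : R :=
  IZR (fib_floor theta n - fib_floor theta (n - 1)).

Lemma Int_part_bounds (r : R) : IZR (Int_part r) <= r < IZR (Int_part r) + 1.
Proof. destruct (base_Int_part r). lra. Qed.

Lemma fib_floor_sturmian (theta : R) : sturmian (fib_floor theta).
Proof.
  exists (theta + alpha). intro n. unfold fib_floor.
  assert (H := Int_part_bounds (IZR (n + 1) * alpha + theta)).
  rewrite plus_IZR in *. lra.
Qed.

Lemma fib_hierarchy (theta : R) : hierarchy (fib_letter theta).
Proof. exact (sturmian_hierarchy _ (fib_floor_sturmian theta)). Qed.

(** Adding [alpha] to [n alpha + theta] crosses an integer exactly when the fractional part is at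
    least [1 - alpha]; hence the index [n + 1] in [fib_floor]. *)
Lemma fib_b_letter (theta : R) (n : nat) : fib_b theta n = fib_letter theta (Z.of_nat n).
Proof.
  unfold fib_b, fib_letter, fib_floor, frac_part. rewrite INR_IZR_INZ.
  replace (Z.of_nat n - 1 + 1)%Z with (Z.of_nat n) by lia.
  rewrite plus_IZR. set (m := IZR (Z.of_nat n)).
  assert (H1 := Int_part_bounds (m * alpha + theta)).
  assert (H2 := Int_part_bounds ((m + 1) * alpha + theta)).
  assert (A := alpha_bounds).
  set (p := Int_part (m * alpha + theta)) in *.
  set (q := Int_part ((m + 1) * alpha + theta)) in *.
  assert (C : q = p \/ q = (p + 1)%Z).
  { assert (L1 : (p - 1 < q)%Z) by (apply lt_IZR; rewrite minus_IZR; lra).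
    assert (L2 : (q < p + 2)%Z) by (apply lt_IZR; rewrite plus_IZR; lra). lia. }
  destruct (Rle_dec (1 - alpha) (m * alpha + theta - IZR p)) as [l|l].
  - destruct (Rlt_dec (m * alpha + theta - IZR p) 1) as [l'|l']; [|lra].
    destruct C as [C|C]; rewrite C in *; rewrite ?plus_IZR in *; [lra|].
    rewrite minus_IZR, plus_IZR. lra.
  - destruct C as [C|C]; rewrite C in *; rewrite ?plus_IZR in *; [|lra].
    rewrite minus_IZR. lra.
Qed.

Fixpoint block_lengths (k : nat) : Z * Z :=
  match k with
  | O => (1, 1)%Z
  | S j => let (l, s) := block_lengths j in (l + s, l)%Z
  end.

Definition long_length (k : nat) : Z := fst (block_lengths k).
Definition short_length (k : nat) : Z := snd (block_lengths k).

Lemma long_length_S (k : nat) : long_length (S k) = (long_length k + short_length k)%Z.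
Proof. unfold long_length, short_length. cbn. destruct (block_lengths k). reflexivity. Qed.

Lemma short_length_S (k : nat) : short_length (S k) = long_length k.
Proof. unfold long_length, short_length. cbn. destruct (block_lengths k). reflexivity. Qed.

Lemma block_lengths_pos (k : nat) : (1 <= short_length k <= long_length k)%Z.
Proof.
  induction k as [|k IH]; [cbv; split; discriminate|].
  rewrite long_length_S, short_length_S. lia.
Qed.

Section Blocks.

Context {c : Z -> R} (h : hierarchy c).

Lemma bd_next (k : nat) (i : Z) :
  bd h k (i + 1)%Z =
  (bd h k i + if tp h k i then long_length k else short_length k)%Z.
Proof.
  revert i. induction k as [|k IH]; intro i.
  - rewrite !bd_0. destruct (tp h 0 i); reflexivity.
  - rewrite !bd_S, long_length_S, short_length_S.
    destruct (tp h (S k) i) eqn:E.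
    + destruct (tp_long _ h k i E) as [E1 [E2 ->]].
      replace (rt h k i + 2)%Z with (rt h k i + 1 + 1)%Z by lia.
      rewrite IH, E2, IH, E1. lia.
    + destruct (tp_short _ h k i E) as [E1 ->]. rewrite IH, E1. lia.
Qed.

Lemma bd_cover (k : nat) (n : Z) : exists i, (bd h k i < n <= bd h k (i + 1))%Z.
Proof.
  induction k as [|k [i IH]].
  - exists (n - 1)%Z. rewrite !bd_0. lia.
  - destruct (rt_cover _ h k i) as [l Hl]. exists l. rewrite !bd_S.
    destruct (tp h (S k) l) eqn:E.
    + destruct (tp_long _ h k l E) as [E1 [E2 E3]]. rewrite E3 in *.
      replace (rt h k l + 2)%Z with (rt h k l + 1 + 1)%Z by lia.
      assert (P := block_lengths_pos k).
      assert (C : i = rt h k l \/ i = (rt h k l + 1)%Z) by lia.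
      destruct C as [-> | ->]; rewrite (bd_next k (rt h k l + 1)%Z) in *;
        rewrite (bd_next k (rt h k l)) in *; rewrite E1, E2 in *; lia.
    + destruct (tp_short _ h k l E) as [E1 E2]. rewrite E2 in *.
      replace i with (rt h k l) in IH by lia. lia.
Qed.

(** Both substitution rules end in a long block, so what precedes a boundary does not depend on the
    type of the block there. This drives the induction for [boundary_content] and supplies the left
    neighbour in [square_end_short]. *)
Lemma rt_prev_long (k : nat) (i : Z) : tp h k (rt h k i - 1)%Z = true.
Proof.
  replace i with (i - 1 + 1)%Z by lia. set (l := (i - 1)%Z).
  destruct (tp h (S k) l) eqn:E.
  - destruct (tp_long _ h k l E) as [E1 [E2 ->]].
    replace (rt h k l + 2 - 1)%Z with (rt h k l + 1)%Z by lia. exact E2.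
  - destruct (tp_short _ h k l E) as [E1 ->].
    replace (rt h k l + 1 - 1)%Z with (rt h k l) by lia. exact E1.
Qed.

Lemma block_content (k : nat) (i i' j : Z) : tp h k i = tp h k i' ->
  (0 <= j < if tp h k i then long_length k else short_length k)%Z ->
  c (bd h k (i + 1) - j)%Z = c (bd h k (i' + 1) - j)%Z.
Proof.
  revert i i' j. induction k as [|k IH]; intros i i' j E Hj.
  - replace j with 0%Z by (destruct (tp h 0 i); cbn in Hj; lia).
    rewrite !Z.sub_0_r, !bd_0, !(tp_0 _ h), E. reflexivity.
  - rewrite !bd_S. rewrite long_length_S, short_length_S in Hj.
    destruct (tp h (S k) i) eqn:E1; symmetry in E.
    + destruct (tp_long _ h k i E1) as [A1 [A2 ->]].
      destruct (tp_long _ h k i' E) as [B1 [B2 ->]].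
      replace (rt h k i + 2)%Z with (rt h k i + 1 + 1)%Z by lia.
      replace (rt h k i' + 2)%Z with (rt h k i' + 1 + 1)%Z by lia.
      destruct (Z_lt_ge_dec j (long_length k)).
      * apply IH; [congruence|]. rewrite A2. lia.
      * rewrite (bd_next k (rt h k i + 1)%Z), (bd_next k (rt h k i' + 1)%Z), A2, B2.
        rewrite <- !Z.add_sub_assoc.
        replace (long_length k - j)%Z with (- (j - long_length k))%Z by lia.
        rewrite !Z.add_opp_r. apply IH; [congruence|]. rewrite A1. lia.
    + destruct (tp_short _ h k i E1) as [A1 ->].
      destruct (tp_short _ h k i' E) as [B1 ->].
      apply IH; [congruence|]. rewrite A1. lia.
Qed.

(* [s_k s_{k-1}] and [s_{k-1} s_k] differ only in their first two letters. *)
Lemma boundary_content (k : nat) (i i' j : Z) :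
  (0 <= j < long_length k + short_length k - 2)%Z ->
  c (bd h k i - j)%Z = c (bd h k i' - j)%Z.
Proof.
  revert i i' j. induction k as [|k IH]; intros i i' j Hj.
  - cbv [long_length short_length block_lengths fst snd] in Hj. lia.
  - rewrite !bd_S. rewrite long_length_S, short_length_S in Hj.
    assert (A := rt_prev_long k i). assert (B := rt_prev_long k i').
    set (l := (rt h k i - 1)%Z) in *. set (l' := (rt h k i' - 1)%Z) in *.
    replace (rt h k i) with (l + 1)%Z by (unfold l; lia).
    replace (rt h k i') with (l' + 1)%Z by (unfold l'; lia).
    destruct (Z_lt_ge_dec j (long_length k)).
    + apply block_content; [congruence|]. rewrite A. lia.
    + rewrite !bd_next, A, B. rewrite <- !Z.add_sub_assoc.
      replace (long_length k - j)%Z with (- (j - long_length k))%Z by lia.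
      rewrite !Z.add_opp_r. apply IH. lia.
Qed.

(** The two ends of a long block are boundaries at distance [long_length k], preceded by the same
    letters. That agreement is longer than the block by [short_length k - 2] letters, which carries
    the period beyond its left end. *)
Lemma period_long (k : nat) (i n : Z) : tp h k i = true ->
  (bd h k i - short_length k + 2 < n <= bd h k i + long_length k)%Z ->
  c n = c (n - long_length k)%Z.
Proof.
  intros E Hn. assert (N := bd_next k i). rewrite E in N.
  replace n with (bd h k (i + 1) - (bd h k (i + 1) - n))%Z at 1 by lia.
  replace (n - long_length k)%Z with (bd h k i - (bd h k (i + 1) - n))%Z by lia.
  apply boundary_content. lia.
Qed.

End Blocks.

(** * Transfer matrices and the trace map *)

Record mat : Type := Mat { m11 : R; m12 : R; m21 : R; m22 : R }.

Definition mmul (A B : mat) : mat :=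
  Mat (m11 A * m11 B + m12 A * m21 B) (m11 A * m12 B + m12 A * m22 B)
      (m21 A * m11 B + m22 A * m21 B) (m21 A * m12 B + m22 A * m22 B).
Definition mone : mat := Mat 1 0 0 1.
Definition madj (A : mat) : mat := Mat (m22 A) (- m12 A) (- m21 A) (m11 A).
Definition mtr (A : mat) : R := m11 A + m22 A.
Definition mdet (A : mat) : R := m11 A * m22 A - m12 A * m21 A.

Ltac mat_ring :=
  intros; repeat match goal with A : mat |- _ => destruct A end;
  unfold mmul, mone, madj, mtr, mdet; cbn [m11 m12 m21 m22];
  try (f_equal; ring); try ring.

Lemma mmul_assoc (A B C : mat) : mmul A (mmul B C) = mmul (mmul A B) C.
Proof. mat_ring. Qed.
Lemma mmul_1_l (A : mat) : mmul mone A = A.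
Proof. mat_ring. Qed.
Lemma mmul_1_r (A : mat) : mmul A mone = A.
Proof. mat_ring. Qed.
Lemma mdet_mul (A B : mat) : mdet (mmul A B) = mdet A * mdet B.
Proof. mat_ring. Qed.

Lemma mtr_conj (V W T : mat) : mdet T = 1 -> mmul V T = mmul T W -> mtr V = mtr W.
Proof.
  intros D E.
  assert (H : mtr (mmul (mmul V T) (madj T)) = mdet T * mtr V) by mat_ring.
  assert (H' : mtr (mmul (mmul T W) (madj T)) = mdet T * mtr W) by mat_ring.
  rewrite E in H. rewrite D in *. lra.
Qed.

Definition transfer (x b : R) : mat := Mat (x - b) (-1) 1 0.

Lemma transfer_det (x b : R) : mdet (transfer x b) = 1.
Proof. unfold transfer, mdet; cbn; ring. Qed.

Fixpoint window (c : Z -> R) (x : R) (m : Z) (p : nat) : mat :=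
  match p with
  | O => mone
  | S q => mmul (transfer x (c (m + Z.of_nat q + 1)%Z)) (window c x m q)
  end.

Lemma window_det (c : Z -> R) (x : R) (m : Z) (p : nat) : mdet (window c x m p) = 1.
Proof.
  induction p as [|p IH]; cbn [window]; [unfold mdet, mone; cbn; ring|].
  rewrite mdet_mul, IH, transfer_det. ring.
Qed.

Lemma window_add (c : Z -> R) (x : R) (m : Z) (p q : nat) :
  window c x m (p + q) = mmul (window c x (m + Z.of_nat p) q) (window c x m p).
Proof.
  induction q as [|q IH].
  - rewrite Nat.add_0_r. cbn [window]. rewrite mmul_1_l. reflexivity.
  - rewrite Nat.add_succ_r. cbn [window]. rewrite IH, mmul_assoc.
    do 4 f_equal. lia.
Qed.

Lemma window_ext (c : Z -> R) (x : R) (m m' : Z) (p : nat) :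
  (forall j, (0 < j <= Z.of_nat p)%Z -> c (m + j)%Z = c (m' + j)%Z) ->
  window c x m p = window c x m' p.
Proof.
  intro H. induction p as [|p IH]; cbn [window]; [reflexivity|].
  rewrite IH by (intros j Hj; apply H; lia).
  do 2 f_equal. rewrite <- !Z.add_assoc. apply H. lia.
Qed.

(** Sliding the window by one letter conjugates it by the transfer matrix of the letter that leaves,
    since by periodicity the same letter enters. *)
Lemma window_trace_shift (c : Z -> R) (x : R) (p : nat) (m m' : Z) : (m <= m')%Z ->
  (forall n, (m + Z.of_nat p < n <= m' + Z.of_nat p)%Z -> c n = c (n - Z.of_nat p)%Z) ->
  mtr (window c x m' p) = mtr (window c x m p).
Proof.
  intros L. replace m' with (m + Z.of_nat (Z.to_nat (m' - m)))%Z by lia.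
  induction (Z.to_nat (m' - m)) as [|d IH]; intro H.
  - replace (m + Z.of_nat 0)%Z with m by lia. reflexivity.
  - rewrite <- IH by (intros n Hn; apply H; lia).
    set (e := (m + Z.of_nat d)%Z).
    replace (m + Z.of_nat (S d))%Z with (e + Z.of_nat 1)%Z by (unfold e; lia).
    apply mtr_conj with (T := transfer x (c (e + 1)%Z)); [apply transfer_det|].
    assert (A := window_add c x e 1 p). cbn [Nat.add window] in A.
    rewrite mmul_1_r in A. replace (e + Z.of_nat 0 + 1)%Z with (e + 1)%Z in A by lia.
    rewrite <- A. rewrite H by (unfold e; lia). do 3 f_equal. lia.
Qed.

(** Transfer matrices compose from right to left: a short block followed by a long one has the
    matrix [L S]. *)
Fixpoint block_mats (x : R) (k : nat) : mat * mat :=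
  match k with
  | O => (transfer x 1, transfer x 0)
  | S j => let (L, S) := block_mats x j in (mmul L S, L)
  end.

Definition long_mat (x : R) (k : nat) : mat := fst (block_mats x k).
Definition short_mat (x : R) (k : nat) : mat := snd (block_mats x k).

Lemma long_mat_S (x : R) (k : nat) : long_mat x (S k) = mmul (long_mat x k) (short_mat x k).
Proof. unfold long_mat, short_mat. cbn. destruct (block_mats x k). reflexivity. Qed.

Lemma short_mat_S (x : R) (k : nat) : short_mat x (S k) = long_mat x k.
Proof. unfold long_mat, short_mat. cbn. destruct (block_mats x k). reflexivity. Qed.

Lemma block_mats_det (x : R) (k : nat) :
  mdet (long_mat x k) = 1 /\ mdet (short_mat x k) = 1.
Proof.
  induction k as [|k [A B]]; [split; apply transfer_det|].
  rewrite long_mat_S, short_mat_S, mdet_mul, A, B. split; ring.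
Qed.

Definition long_trace (x : R) (k : nat) : R := mtr (long_mat x k).
Definition short_trace (x : R) (k : nat) : R := mtr (short_mat x k).

Lemma short_trace_S (x : R) (k : nat) : short_trace x (S k) = long_trace x k.
Proof. unfold short_trace. rewrite short_mat_S. reflexivity. Qed.

Lemma trace_map (x : R) (k : nat) :
  long_trace x (S (S k)) = long_trace x (S k) * long_trace x k - short_trace x k.
Proof.
  unfold long_trace, short_trace.
  rewrite long_mat_S, short_mat_S, long_mat_S.
  destruct (block_mats_det x k) as [D _].
  (* This is Cayley-Hamilton for [A], multiplied by [B] under the trace. *)
  assert (H : forall A B : mat,
    mtr (mmul (mmul A B) A) = mtr (mmul A B) * mtr A - mdet A * mtr B) by mat_ring.
  rewrite H, D. ring.
Qed.

(** This is the Fricke-Vogt invariant written in full traces; 5 is 4 plus the square of the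
    coupling, the difference 1 of the two letter values. *)
Lemma trace_invariant (x : R) (k : nat) :
  long_trace x (S k) ^ 2 + long_trace x k ^ 2 + short_trace x k ^ 2
  - long_trace x (S k) * long_trace x k * short_trace x k = 5.
Proof.
  induction k as [|k IH].
  - unfold long_trace, short_trace, long_mat, short_mat, mtr, mmul, transfer; cbn. ring.
  - rewrite trace_map, short_trace_S. rewrite <- IH. ring.
Qed.

(** * Squares centred at or ending at a given position *)

Section Squares.

Context {c : Z -> R} (h : hierarchy c) (x : R).

Lemma window_block (k : nat) (i : Z) :
  window c x (bd h k i) (Z.to_nat (if tp h k i then long_length k else short_length k))
  = if tp h k i then long_mat x k else short_mat x k.
Proof.
  revert i. induction k as [|k IH]; intro i.
  - assert (T := tp_0 _ h i). rewrite bd_0.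
    assert (W : window c x i 1 = transfer x (c (i + 1)%Z))
      by (cbn [window]; rewrite mmul_1_r; do 2 f_equal; cbn; lia).
    destruct (tp h 0 i); [change (Z.to_nat (long_length 0)) with 1%nat
      | change (Z.to_nat (short_length 0)) with 1%nat];
      rewrite W, T; reflexivity.
  - rewrite bd_S, long_length_S, short_length_S, long_mat_S, short_mat_S.
    assert (P := block_lengths_pos k).
    destruct (tp h (S k) i) eqn:E.
    + destruct (tp_long _ h k i E) as [E1 [E2 _]].
      assert (I1 := IH (rt h k i)). assert (I2 := IH (rt h k i + 1)%Z).
      rewrite bd_next in I2. rewrite E1 in I1, I2. rewrite E2 in I2.
      rewrite Z.add_comm, Z2Nat.inj_add, window_add by lia.
      rewrite Z2Nat.id by lia. rewrite I1, I2. reflexivity.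
    + destruct (tp_short _ h k i E) as [E1 _].
      assert (I1 := IH (rt h k i)). rewrite E1 in I1. exact I1.
Qed.

Definition long_len (k : nat) : nat := Z.to_nat (long_length k).

Lemma long_len_Z (k : nat) : Z.of_nat (long_len k) = long_length k.
Proof. unfold long_len. assert (P := block_lengths_pos k). lia. Qed.

(* The square occupies the letters in [(m - p, m + p]], where [p = long_length k]. *)
Definition square_at (k : nat) (m : Z) : Prop :=
  (forall n, (m < n <= m + long_length k)%Z -> c n = c (n - long_length k)%Z)
  /\ mtr (window c x m (long_len k)) = long_trace x k.

Lemma square_before_long (k : nat) (i m : Z) : tp h k i = true ->
  (bd h k i - short_length k + 2 <= m <= bd h k i)%Z -> square_at k m.
Proof.
  intros E Hm. assert (Per := fun n => period_long h k i n E).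
  assert (P := block_lengths_pos k). split.
  - intros n Hn. apply Per. lia.
  - rewrite <- (window_trace_shift c x (long_len k) m (bd h k i)).
    + assert (W := window_block k i). rewrite E in W.
      unfold long_trace. rewrite <- W. reflexivity.
    + lia.
    + intros n Hn. rewrite long_len_Z in *. apply Per. lia.
Qed.

(** Each long block repeats the letters before it, so the period runs through both blocks. The bound
    [2 <= short_length k] makes it start at the first letter of each. *)
Lemma square_in_long_long (k : nat) (i m : Z) : (2 <= short_length k)%Z ->
  tp h k i = true -> tp h k (i + 1)%Z = true ->
  (bd h k i <= m <= bd h k (i + 1))%Z -> square_at k m.
Proof.
  intros H2 E E' Hm. assert (Per := fun n => period_long h k i n E).
  assert (Per' := fun n => period_long h k (i + 1)%Z n E').
  assert (N := bd_next h k i). rewrite E in N.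
  assert (P := block_lengths_pos k).
  assert (Q : forall n, (bd h k i < n <= bd h k i + 2 * long_length k)%Z ->
     c n = c (n - long_length k)%Z).
  { intros n Hn. destruct (Z_le_gt_dec n (bd h k i + long_length k));
      [apply Per | apply Per']; lia. }
  split.
  - intros n Hn. apply Q. lia.
  - rewrite (window_trace_shift c x (long_len k) (bd h k i) m).
    + assert (W := window_block k i). rewrite E in W.
      unfold long_trace. rewrite <- W. reflexivity.
    + lia.
    + intros n Hn. rewrite long_len_Z in *. apply Q. lia.
Qed.

(** The next block is long, and its squares have centres reaching back over the whole short block
    except the first position. This exception is the origin of the shift to [m + 1]. *)
Lemma square_center_short (k : nat) (i m : Z) : (2 <= short_length k)%Z ->
  tp h k i = false -> (bd h k i < m <= bd h k (i + 1))%Z ->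
  square_at k m \/ square_at k (m + 1)%Z.
Proof.
  intros H2 E Hm. assert (N := bd_next h k i). rewrite E in N.
  assert (E' := short_isolated _ h k i E).
  destruct (Z.eq_dec m (bd h k i + 1)); [right | left];
    apply (square_before_long k (i + 1)%Z); trivial; lia.
Qed.

Lemma square_center (k : nat) (m : Z) : (2 <= short_length k)%Z ->
  exists j m', (j = k \/ j = S k) /\ (m' = m \/ m' = m + 1)%Z /\ square_at j m'.
Proof.
  intros H2. assert (P := block_lengths_pos k).
  assert (H2' : (2 <= short_length (S k))%Z) by (rewrite short_length_S; lia).
  destruct (bd_cover h (S k) m) as [i Hi].
  destruct (tp h (S k) i) eqn:E.
  - destruct (tp h (S k) (i + 1)%Z) eqn:E'.
    + exists (S k), m. split; [lia|]. split; [lia|].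
      apply (square_in_long_long (S k) i); trivial. lia.
    (* At level [k] the two blocks read short, long, long: the short block of level [k + 1] is
       itself a long one of level [k]. *)
    + destruct (tp_long _ h k i E) as [A1 [A2 A3]].
      destruct (tp_short _ h k _ E') as [B1 _]. rewrite A3 in B1.
      rewrite !bd_S, A3 in Hi. set (r := rt h k i) in *.
      destruct (Z_le_gt_dec m (bd h k (r + 1)%Z)).
      * destruct (square_center_short k r m H2 A1 ltac:(lia)) as [H|H];
          [exists k, m | exists k, (m + 1)%Z]; auto.
      * exists k, m. split; [lia|]. split; [lia|].
        apply (square_in_long_long k (r + 1)%Z); trivial;
          replace (r + 1 + 1)%Z with (r + 2)%Z by lia; trivial; lia.
  - destruct (square_center_short (S k) i m H2' E Hi) as [H|H];
      [exists (S k), m | exists (S k), (m + 1)%Z]; auto.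
Qed.

(** At level [k] this block is long and follows a long one; a square ending at [n] has its centre in
    the first of the two. *)
Lemma square_end_short (k : nat) (i n : Z) : (2 <= short_length k)%Z ->
  tp h (S k) i = false -> (bd h (S k) i < n <= bd h (S k) (i + 1))%Z ->
  square_at k (n - long_length k)%Z.
Proof.
  intros H2 E Hn. destruct (tp_short _ h k i E) as [A1 A2].
  assert (B := rt_prev_long h k i). rewrite !bd_S, A2 in Hn.
  rewrite bd_next, A1 in Hn.
  set (r := (rt h k i - 1)%Z) in *.
  replace (rt h k i) with (r + 1)%Z in * by (unfold r; lia).
  assert (N := bd_next h k r). rewrite B in N.
  apply (square_in_long_long k r); trivial. lia.
Qed.

Lemma square_end_long (k : nat) (i n : Z) : tp h k i = true ->
  (bd h k (i + 1) - short_length k + 2 <= n <= bd h k (i + 1))%Z ->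
  square_at k (n - long_length k)%Z.
Proof.
  intros E Hn. assert (N := bd_next h k i). rewrite E in N.
  apply (square_before_long k i); trivial. lia.
Qed.

Lemma square_end (k : nat) (n : Z) : (2 <= short_length k)%Z ->
  exists j, (k <= j <= k + 3)%nat /\ square_at j (n - long_length j)%Z.
Proof.
  intros H2. assert (P := block_lengths_pos k).
  assert (H2' : (2 <= short_length (S k))%Z) by (rewrite short_length_S; lia).
  assert (P' := block_lengths_pos (S k)).
  assert (H2'' : (2 <= short_length (S (S k)))%Z) by (rewrite short_length_S; lia).
  destruct (bd_cover h (S (S k)) n) as [i Hi].
  destruct (tp h (S (S k)) i) eqn:E.
  2: { exists (S k). split; [lia|]. apply (square_end_short (S k) i); trivial. }
  destruct (tp_long _ h (S k) i E) as [A1 [A2 A3]].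
  assert (Hi' := Hi). rewrite !bd_S with (k := S k), A3 in Hi'.
  set (r := rt h (S k) i) in *.
  destruct (Z_le_gt_dec n (bd h (S k) (r + 1)%Z)).
  { exists k. split; [lia|]. apply (square_end_short k r); trivial. lia. }
  assert (N := bd_next h (S k) (r + 1)%Z). rewrite A2 in N.
  replace (r + 1 + 1)%Z with (r + 2)%Z in N by lia.
  set (e := bd h (S (S k)) (i + 1)%Z).
  assert (Ee : e = bd h (S k) (r + 2)%Z) by (unfold e; rewrite bd_S, A3; reflexivity).
  (* Now [n] lies in the final part of the long block, which has [short_length (S (S k))] letters;
     [square_end_long] reaches all of them but the first. For that one, level [k + 3] decides: block
     [i] either ends a long block there or is a short one. *)
  destruct (Z.eq_dec n (e - short_length (S (S k)) + 1)) as [Hx|Hx].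
  2: { exists (S (S k)). split; [lia|]. apply (square_end_long (S (S k)) i); trivial.
       fold e. rewrite short_length_S in *. lia. }
  destruct (rt_cover _ h (S (S k)) i) as [l Hl].
  destruct (tp h (S (S (S k))) l) eqn:El.
  - destruct (tp_long _ h (S (S k)) l El) as [B1 [B2 B3]].
    assert (i = rt h (S (S k)) l + 1)%Z.
    { destruct (Z.eq_dec i (rt h (S (S k)) l)) as [->|]; [congruence|lia]. }
    exists (S (S (S k))). split; [lia|].
    apply (square_end_long _ l); trivial.
    rewrite bd_S, B3.
    replace (rt h (S (S k)) l + 2)%Z with (i + 1)%Z by lia. fold e.
    rewrite short_length_S, (long_length_S (S k)) in *. rewrite short_length_S in *. lia.
  - destruct (tp_short _ h (S (S k)) l El) as [B1 B2].
    assert (i = rt h (S (S k)) l) by lia.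
    exists (S (S k)). split; [lia|].
    apply (square_end_short (S (S k)) l); trivial.
    rewrite !bd_S with (k := S (S k)), B2, <- H. exact Hi.
Qed.

End Squares.

(** * Squares and solutions of the recurrence *)

Lemma Rabs_le_iff (a b : R) : Rabs a <= b <-> - b <= a <= b.
Proof. split; intro H; [unfold Rabs in H; destruct (Rcase_abs a); lra | apply Rabs_le; lra]. Qed.

Lemma Rabs_self (a : R) : - Rabs a <= a <= Rabs a.
Proof. split_Rabs; lra. Qed.

Lemma Rabs_comb3 (a b c d : R) : a = b + c + d -> Rabs a <= Rabs b + Rabs c + Rabs d.
Proof.
  intros ->. apply Rabs_le_iff. assert (B := Rabs_self b). assert (C := Rabs_self c).
  assert (D := Rabs_self d). lra.
Qed.

Lemma Rabs_mul_le (a b A B : R) : Rabs a <= A -> Rabs b <= B -> Rabs (a * b) <= A * B.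
Proof.
  intros H1 H2. rewrite Rabs_mult.
  apply Rmult_le_compat; trivial using Rabs_pos.
Qed.

(** The letters exist on all of [Z], but solutions obey the equation only from 1 on. The source [v]
    is zero for the orthonormal polynomials and [(J - x) u] for an arbitrary vector [u]. *)
Definition recurrence (c : Z -> R) (x : R) (u v : Z -> R) : Prop :=
  forall n, (1 <= n)%Z -> u n = (x - c n) * u (n - 1)%Z - u (n - 2)%Z + v n.

Definition norm2 (u : Z -> R) (m : Z) : R := Rabs (u m) + Rabs (u (m - 1)%Z).

Lemma norm2_pos (u : Z -> R) (m : Z) : 0 <= norm2 u m.
Proof. unfold norm2. assert (H := Rabs_pos (u m)). assert (H' := Rabs_pos (u (m - 1)%Z)). lra. Qed.

Section Estimates.

Context {c : Z -> R} (h : hierarchy c) (x : R) (Hx : forall n, Rabs (x - c n) <= 5)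
  (u v : Z -> R) (Hu : recurrence c x u v).

Lemma norm2_step (m : Z) : (0 <= m)%Z ->
  norm2 u (m + 1) <= 6 * norm2 u m + Rabs (v (m + 1)%Z)
  /\ norm2 u m <= 6 * norm2 u (m + 1) + Rabs (v (m + 1)%Z).
Proof.
  intro Hm. assert (E := Hu (m + 1)%Z ltac:(lia)). unfold norm2.
  replace (m + 1 - 1)%Z with m in * by lia.
  replace (m + 1 - 2)%Z with (m - 1)%Z in * by lia.
  assert (A := Rabs_mul_le _ (u m) _ _ (Hx (m + 1)%Z) (Rle_refl _)).
  set (y := (x - c (m + 1)%Z) * u m) in *. clearbody y.
  assert (E1 := Rabs_comb3 (u (m + 1)%Z) y (- u (m - 1)%Z) (v (m + 1)%Z) ltac:(lra)).
  assert (E2 := Rabs_comb3 (u (m - 1)%Z) y (- u (m + 1)%Z) (v (m + 1)%Z) ltac:(lra)).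
  rewrite Rabs_Ropp in E1, E2.
  assert (P1 := Rabs_pos (u m)). assert (P2 := Rabs_pos (u (m - 1)%Z)).
  assert (P3 := Rabs_pos (u (m + 1)%Z)). assert (P4 := Rabs_pos (v (m + 1)%Z)). lra.
Qed.

Lemma window_entries (m : Z) (p : nat) :
  let W := window c x m p in
  Rabs (m11 W) <= 6 ^ p /\ Rabs (m12 W) <= 6 ^ p
  /\ Rabs (m21 W) <= 6 ^ p /\ Rabs (m22 W) <= 6 ^ p.
Proof.
  cbv zeta. induction p as [|p [A [B [C D]]]].
  - cbn. rewrite Rabs_R0, Rabs_R1. lra.
  - cbn [window]. set (W := window c x m p) in *. clearbody W.
    assert (Hb := Hx (m + Z.of_nat p + 1)%Z).
    unfold mmul, transfer; cbn [m11 m12 m21 m22 pow].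
    assert (E1 := Rabs_mul_le _ _ _ _ Hb A). assert (E2 := Rabs_mul_le _ _ _ _ Hb B).
    set (y1 := (x - c (m + Z.of_nat p + 1)%Z) * m11 W) in *.
    set (y2 := (x - c (m + Z.of_nat p + 1)%Z) * m12 W) in *.
    rewrite !Rabs_le_iff in *. repeat split; lra.
Qed.

(** The base 7 is [5 + 1] from the two terms of the recurrence, plus 1 that absorbs the new source
    term by [w <= 7 ^ p * w]. *)
Lemma window_error (m : Z) (p : nat) (w : R) : (0 <= m)%Z -> 0 <= w ->
  (forall i, (m < i <= m + Z.of_nat p)%Z -> Rabs (v i) <= w) ->
  let W := window c x m p in
  Rabs (u (m + Z.of_nat p)%Z - (m11 W * u m + m12 W * u (m - 1)%Z)) <= 7 ^ p * w
  /\ Rabs (u (m + Z.of_nat p - 1)%Z - (m21 W * u m + m22 W * u (m - 1)%Z)) <= 7 ^ p * w.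
Proof.
  intros Hm Hw. cbv zeta. induction p as [|p IH]; intro Hv.
  - replace (m + Z.of_nat 0)%Z with m by lia. cbn.
    replace (u m - (1 * u m + 0 * u (m - 1)%Z)) with 0 by ring.
    replace (u (m - 1)%Z - (0 * u m + 1 * u (m - 1)%Z)) with 0 by ring.
    rewrite Rabs_R0. lra.
  - destruct IH as [A B]; [intros i Hi; apply Hv; lia|].
    cbn [window]. set (W := window c x m p) in *. clearbody W.
    set (n := (m + Z.of_nat p)%Z) in *.
    replace (m + Z.of_nat (S p))%Z with (n + 1)%Z by (unfold n; lia).
    assert (Hvn := Hv (n + 1)%Z ltac:(unfold n; lia)).
    rewrite (Hu (n + 1)%Z) by (unfold n; lia).
    replace (n + 1 - 1)%Z with n by lia. replace (n + 1 - 2)%Z with (n - 1)%Z by lia.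
    assert (E := Rabs_mul_le _ _ _ _ (Hx (n + 1)%Z) A).
    assert (P := pow_le 7 p ltac:(lra)). assert (P1 := pow_R1_Rle 7 p ltac:(lra)).
    assert (PW : 1 * w <= 7 ^ p * w) by (apply Rmult_le_compat_r; lra).
    unfold mmul, transfer; cbn [m11 m12 m21 m22 pow].
    set (d := x - c (n + 1)%Z) in *. clearbody d.
    set (q := 7 ^ p * w) in *. replace (7 * 7 ^ p * w) with (7 * q) by (unfold q; ring).
    split.
    + match goal with |- Rabs ?e <= _ =>
        replace e with (d * (u n - (m11 W * u m + m12 W * u (m - 1)%Z))
          - (u (n - 1)%Z - (m21 W * u m + m22 W * u (m - 1)%Z)) + v (n + 1)%Z) by ring
      end.
      rewrite !Rabs_le_iff in *. lra.
    + match goal with |- Rabs ?e <= _ =>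
        replace e with (u n - (m11 W * u m + m12 W * u (m - 1)%Z)) by ring end.
      rewrite !Rabs_le_iff in *. lra.
Qed.

Definition square_const (p : nat) : R := 7 ^ p * (1 + 2 * 6 ^ p).

Lemma square_const_pos (p : nat) : 0 <= square_const p.
Proof.
  unfold square_const. assert (A := pow_le 7 p ltac:(lra)).
  assert (B := pow_le 6 p ltac:(lra)). nra.
Qed.

(* Cayley-Hamilton: [A + A^-1 = tr A]. *)
Lemma square_relation (k : nat) (m : Z) (w : R) : square_at (c := c) x k m ->
  (long_length k <= m)%Z -> 0 <= w ->
  (forall i, (m - long_length k < i <= m + long_length k)%Z -> Rabs (v i) <= w) ->
  Rabs (u (m + long_length k)%Z + u (m - long_length k)%Z - long_trace x k * u m)
    <= square_const (long_len k) * w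
  /\ Rabs (u (m + long_length k - 1)%Z + u (m - long_length k - 1)%Z
           - long_trace x k * u (m - 1)%Z) <= square_const (long_len k) * w.
Proof.
  intros [Per Tr] Hm Hw Hv. rewrite <- long_len_Z in *. set (p := long_len k) in *.
  assert (EW : window c x (m - Z.of_nat p) p = window c x m p).
  { apply window_ext. intros j Hj. rewrite (Per (m + j)%Z) by lia. f_equal. lia. }
  destruct (window_error (m - Z.of_nat p) p w ltac:(lia) Hw
              ltac:(intros i Hi; apply Hv; lia)) as [A B].
  destruct (window_error m p w ltac:(lia) Hw
              ltac:(intros i Hi; apply Hv; lia)) as [C D].
  cbv zeta in A, B, C, D.
  destruct (window_entries m p) as [W1 [W2 [W3 W4]]].
  assert (Dt := window_det c x m p).
  rewrite EW in A, B. set (W := window c x m p) in *. clearbody W.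
  replace (m - Z.of_nat p + Z.of_nat p)%Z with m in * by lia.
  rewrite <- Tr. unfold mtr, mdet in *.
  set (a1 := u (m - Z.of_nat p)%Z) in *. set (a2 := u (m - Z.of_nat p - 1)%Z) in *.
  set (b1 := u m) in *. set (b2 := u (m - 1)%Z) in *.
  set (c1 := u (m + Z.of_nat p)%Z) in *. set (c2 := u (m + Z.of_nat p - 1)%Z) in *.
  set (e1 := b1 - (m11 W * a1 + m12 W * a2)) in *.
  set (e2 := b2 - (m21 W * a1 + m22 W * a2)) in *.
  unfold square_const. set (q := 7 ^ p * w) in *.
  replace (7 ^ p * (1 + 2 * 6 ^ p) * w) with (q + 6 ^ p * q + 6 ^ p * q) by (unfold q; ring).
  assert (F1 := Rabs_mul_le _ _ _ _ W1 B). assert (F2 := Rabs_mul_le _ _ _ _ W2 B).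
  assert (F3 := Rabs_mul_le _ _ _ _ W3 A). assert (F4 := Rabs_mul_le _ _ _ _ W4 A).
  split.
  (* The terms in [e1] and [e2] are minus the first row of [madj W] applied to the error on the left
     half; the last summand vanishes because [W] has determinant 1. *)
  - replace (c1 + a1 - (m11 W + m22 W) * b1)
      with ((c1 - (m11 W * b1 + m12 W * b2)) - m22 W * e1 + m12 W * e2
            + (1 - (m11 W * m22 W - m12 W * m21 W)) * a1) by (unfold e1, e2; ring).
    rewrite Dt. rewrite !Rabs_le_iff in *. lra.
  - replace (c2 + a2 - (m11 W + m22 W) * b2)
      with ((c2 - (m21 W * b1 + m22 W * b2)) + m21 W * e1 - m11 W * e2
            + (1 - (m11 W * m22 W - m12 W * m21 W)) * a2) by (unfold e1, e2; ring).
    rewrite Dt. rewrite !Rabs_le_iff in *. lra.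
Qed.

Lemma square_forward (k : nat) (m : Z) (B : R) : square_at (c := c) x k m ->
  (long_length k <= m)%Z -> (forall i, v i = 0) -> Rabs (long_trace x k) <= B ->
  norm2 u (m + long_length k) <= B * norm2 u m + norm2 u (m - long_length k).
Proof.
  intros Hs Hm Hv HB.
  destruct (square_relation k m 0 Hs Hm (Rle_refl 0)) as [R1 R2].
  { intros i _. rewrite Hv, Rabs_R0. lra. }
  rewrite !Rmult_0_r in *. unfold norm2.
  assert (E1 := Rabs_mul_le _ (u m) _ _ HB (Rle_refl _)).
  assert (E2 := Rabs_mul_le _ (u (m - 1)%Z) _ _ HB (Rle_refl _)).
  set (y1 := long_trace x k * u m) in *. set (y2 := long_trace x k * u (m - 1)%Z) in *.
  replace (B * (Rabs (u m) + Rabs (u (m - 1)%Z)))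
    with (B * Rabs (u m) + B * Rabs (u (m - 1)%Z)) by ring.
  assert (F1 := Rabs_comb3 (u (m + long_length k)%Z)
    (u (m + long_length k)%Z + u (m - long_length k)%Z - y1) y1
    (- u (m - long_length k)%Z) ltac:(ring)).
  assert (F2 := Rabs_comb3 (u (m + long_length k - 1)%Z)
    (u (m + long_length k - 1)%Z + u (m - long_length k - 1)%Z - y2) y2
    (- u (m - long_length k - 1)%Z) ltac:(ring)).
  rewrite Rabs_Ropp in F1, F2. lra.
Qed.

Lemma square_center_bound (k : nat) (m : Z) (w B : R) : square_at (c := c) x k m ->
  (long_length k <= m)%Z -> 0 <= w ->
  (forall i, (m - long_length k < i <= m + long_length k)%Z -> Rabs (v i) <= w) ->
  B <= Rabs (long_trace x k) ->
  B * norm2 u m <= norm2 u (m + long_length k) + norm2 u (m - long_length k)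
                   + 2 * square_const (long_len k) * w.
Proof.
  intros Hs Hm Hw Hv HB.
  destruct (square_relation k m w Hs Hm Hw Hv) as [R1 R2].
  assert (L : B * norm2 u m <= Rabs (long_trace x k) * norm2 u m)
    by (apply Rmult_le_compat_r; trivial using norm2_pos).
  unfold norm2 in *.
  rewrite (Rmult_plus_distr_l (Rabs (long_trace x k))), <- !Rabs_mult in L.
  set (y1 := long_trace x k * u m) in *. set (y2 := long_trace x k * u (m - 1)%Z) in *.
  set (q := square_const (long_len k) * w) in *.
  replace (2 * square_const (long_len k) * w) with (2 * q) by (unfold q; ring).
  clearbody y1 y2 q. rewrite <- Rabs_Ropp in R1, R2.
  assert (F1 := Rabs_comb3 y1
    (- (u (m + long_length k)%Z + u (m - long_length k)%Z - y1))
    (u (m + long_length k)%Z) (u (m - long_length k)%Z) ltac:(ring)).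
  assert (F2 := Rabs_comb3 y2
    (- (u (m + long_length k - 1)%Z + u (m - long_length k - 1)%Z - y2))
    (u (m + long_length k - 1)%Z) (u (m - long_length k - 1)%Z) ltac:(ring)).
  lra.
Qed.

Lemma escape_bound (k : nat) (m : Z) (w : R) : (2 <= short_length k)%Z ->
  200 <= Rabs (long_trace x k) -> 200 <= Rabs (long_trace x (S k)) ->
  (long_length (S k) <= m)%Z -> 0 <= w ->
  (forall i, (m - long_length (S k) <= i <= m + long_length (S k) + 1)%Z ->
     Rabs (v i) <= w) ->
  exists m1 m2, (m - long_length (S k) <= m1 <= m + long_length (S k) + 1)%Z
    /\ (m - long_length (S k) <= m2 <= m + long_length (S k) + 1)%Z
    /\ norm2 u m <= 3 / 100 * (norm2 u m1 + norm2 u m2)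
         + (1 + square_const (long_len k) + square_const (long_len (S k))) * w.
Proof.
  intros H2 T1 T2 Hm Hw Hv.
  assert (P := block_lengths_pos k). assert (LS := long_length_S k).
  destruct (square_center h x k m H2) as [j [m' [Hj [Hm' Hs]]]].
  assert (Lj : (1 <= long_length j <= long_length (S k))%Z) by (destruct Hj as [-> | ->]; lia).
  assert (Tj : 200 <= Rabs (long_trace x j)) by (destruct Hj as [-> | ->]; trivial).
  assert (B := square_center_bound j m' w 200 Hs ltac:(lia) Hw
    ltac:(intros i Hi; apply Hv; lia) Tj).
  exists (m' + long_length j)%Z, (m' - long_length j)%Z.
  split; [lia|]. split; [lia|].
  assert (N : norm2 u m <= 6 * norm2 u m' + w).
  { destruct Hm' as [-> | ->].
    - assert (H := norm2_pos u m). lra.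
    - assert (H := proj2 (norm2_step m ltac:(lia))).
      assert (H' := Hv (m + 1)%Z ltac:(lia)). lra. }
  assert (S1 := square_const_pos (long_len k)).
  assert (S2 := square_const_pos (long_len (S k))).
  assert (S3 : 2 * square_const (long_len j) * w * (3/100)
    <= (square_const (long_len k) + square_const (long_len (S k))) * w).
  { replace (2 * square_const (long_len j) * w * (3/100))
      with (6/100 * square_const (long_len j) * w) by field.
    apply Rmult_le_compat_r; trivial. destruct Hj as [-> | ->]; lra. }
  lra.
Qed.

End Estimates.

(** * Escape of the trace map *)

Definition escaping (x : R) (i : nat) : Prop :=
  3 <= Rabs (long_trace x i) /\ 200 <= Rabs (long_trace x (S i))
  /\ Rabs (short_trace x i) <= Rabs (long_trace x (S i)).

Lemma trace_growth (x : R) (i : nat) :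
  Rabs (long_trace x (S i)) * Rabs (long_trace x i) - Rabs (short_trace x i)
  <= Rabs (long_trace x (S (S i))).
Proof.
  rewrite trace_map, <- Rabs_mult. apply Rabs_triang_inv.
Qed.

(** Let [a], [b] be the absolute traces at [i] and [i + 1]. The subtracted trace is at most [b], so
    the next one is at least [b (a - 1)], which exceeds 200 and also [a]. *)
Lemma escaping_S (x : R) (i : nat) : escaping x i -> escaping x (S i).
Proof.
  intros [A [B C]]. assert (G := trace_growth x i). unfold escaping.
  rewrite short_trace_S.
  set (a := Rabs (long_trace x i)) in *. set (b := Rabs (long_trace x (S i))) in *.
  assert (b * 3 <= b * a) by (apply Rmult_le_compat_l; lra).
  assert (200 * (a - 1) <= b * (a - 1)) by (apply Rmult_le_compat_r; lra).
  repeat split; lra.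
Qed.

Lemma escaping_ge (x : R) (i j : nat) : escaping x i -> (i < j)%nat ->
  200 <= Rabs (long_trace x j).
Proof.
  intros E L. assert (H : escaping x (j - 1)).
  { replace (j - 1)%nat with (i + (j - 1 - i))%nat by lia.
    induction (j - 1 - i)%nat as [|d IH]; [rewrite Nat.add_0_r; exact E|].
    rewrite Nat.add_succ_r. apply escaping_S, IH. }
  destruct H as [_ [H _]]. replace (S (j - 1)) with j in H by lia. exact H.
Qed.

(** If a neighbour of the large trace [y] is at least 3, the trace map escapes from that neighbour
    on. If both are below 3, their product is at most 9, and the invariant would give
    [y ^ 2 <= 9 |y| + 5]. *)
Lemma first_large_escaping (x : R) (j : nat) :
  200 < Rabs (long_trace x (S (S j))) ->
  Rabs (long_trace x (S j)) <= 200 -> Rabs (long_trace x j) <= 200 ->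
  escaping x (S j) \/ escaping x (S (S (S j))).
Proof.
  intros A B C.
  assert (I := trace_invariant x (S (S j))). rewrite short_trace_S in I.
  assert (G := trace_growth x (S (S j))). rewrite short_trace_S in G.
  destruct (Rle_dec 3 (Rabs (long_trace x (S j)))) as [D|D].
  { left. unfold escaping. rewrite short_trace_S. lra. }
  destruct (Rle_dec 3 (Rabs (long_trace x (S (S (S j)))))) as [E|E].
  { right. unfold escaping. rewrite short_trace_S.
    set (a := Rabs (long_trace x (S (S j)))) in *.
    set (b := Rabs (long_trace x (S (S (S j))))) in *.
    assert (3 * a <= b * a) by (apply Rmult_le_compat_r; lra).
    lra. }
  exfalso. clear G.
  set (z := long_trace x (S (S (S j)))) in *. set (y := long_trace x (S (S j))) in *.
  set (w := long_trace x (S j)) in *.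
  assert (M : Rabs (z * w) <= 3 * 3) by (apply Rabs_mul_le; lra).
  assert (M' := Rabs_mul_le _ y _ _ M (Rle_refl _)).
  apply Rabs_le_iff in M'. rewrite <- (pow2_abs y) in I.
  assert (Z2 := pow2_ge_0 z). assert (W2 := pow2_ge_0 w).
  assert (N : z * y * w = z * w * y) by ring. rewrite N in I.
  assert (200 * Rabs y <= Rabs y * Rabs y) by (apply Rmult_le_compat_r; lra).
  cbn [pow] in *. lra.
Qed.

Lemma trace_dichotomy (x : R) (K : nat) : Rabs x <= 4 ->
  (forall j, (j <= K)%nat -> Rabs (long_trace x j) <= 200)
  \/ (forall j, (K + 2 <= j)%nat -> 200 <= Rabs (long_trace x j)).
Proof.
  intros Hx. apply Rabs_le_iff in Hx.
  assert (X0 : Rabs (long_trace x 0) <= 200).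
  { unfold long_trace, long_mat, mtr, transfer; cbn. apply Rabs_le_iff. lra. }
  assert (X1 : Rabs (long_trace x 1) <= 200).
  { unfold long_trace, long_mat, mtr, mmul, transfer; cbn. apply Rabs_le_iff. nra. }
  induction K as [|K IH].
  - left. intros j Hj. replace j with 0%nat by lia. exact X0.
  - destruct IH as [IH|IH]; [|right; intros j Hj; apply IH; lia].
    destruct (Rle_dec (Rabs (long_trace x (S K))) 200) as [L|L].
    + left. intros j Hj. destruct (Nat.eq_dec j (S K)) as [-> |]; [exact L|].
      apply IH. lia.
    + right. destruct K as [|j]; [lra|].
      (* The second alternative controls only the indices beyond [j + 3], while the large trace has
         index [j + 2]; this delay is the 2 in the statement. *)
      destruct (first_large_escaping x j) as [E|E]; try (apply IH; lia); [lra| |];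
        intros i Hi; apply (escaping_ge x _ i E); lia.
Qed.

(** * Bounded traces *)

(** Exactly [r] terms are summed, so that empty sums and the cutting into blocks need no special
    cases. *)
Fixpoint psum (f : nat -> R) (r : nat) : R :=
  match r with O => 0 | S q => psum f q + f q end.

Lemma psum_sum_f_R0 (f : nat -> R) (r : nat) : sum_f_R0 f r = psum f (S r).
Proof. induction r as [|r IH]; [cbn; ring|]. cbn [sum_f_R0]. rewrite IH. reflexivity. Qed.

Lemma psum_ext (f g : nat -> R) (r : nat) :
  (forall d, (d < r)%nat -> f d = g d) -> psum f r = psum g r.
Proof.
  induction r as [|r IH]; intro H; cbn; [reflexivity|].
  rewrite IH, H by (intros; try apply H; lia). reflexivity.
Qed.

Lemma psum_le (f g : nat -> R) (r : nat) :
  (forall d, (d < r)%nat -> f d <= g d) -> psum f r <= psum g r.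
Proof.
  induction r as [|r IH]; intro H; cbn; [lra|].
  assert (H1 := IH ltac:(intros; apply H; lia)). assert (H2 := H r ltac:(lia)). lra.
Qed.

Lemma psum_lin (f g : nat -> R) (a b : R) (r : nat) :
  psum (fun d => a * f d + b * g d) r = a * psum f r + b * psum g r.
Proof. induction r as [|r IH]; cbn; [ring|]. rewrite IH. ring. Qed.

Lemma psum_mono (f : nat -> R) (r s : nat) : (forall d, 0 <= f d) -> (r <= s)%nat ->
  psum f r <= psum f s.
Proof. intros H L. induction L as [|s L IH]; cbn; [lra|]. assert (F := H s). lra. Qed.

Lemma psum_pos (f : nat -> R) (r : nat) : (forall d, 0 <= f d) -> 0 <= psum f r.
Proof. intro H. apply (psum_mono f 0 r H). lia. Qed.

Lemma psum_term (f : nat -> R) (r s d : nat) : (forall d, 0 <= f d) ->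
  (r <= d < s)%nat -> psum f r + f d <= psum f s.
Proof.
  intros H L. assert (A := psum_mono f (S d) s H ltac:(lia)).
  assert (B := psum_mono f r d H ltac:(lia)). cbn in A. lra.
Qed.

Lemma psum_head (f : nat -> R) (r : nat) : psum f (S r) = f O + psum (fun d => f (S d)) r.
Proof. induction r as [|r IH]; [cbn; ring|]. cbn [psum] in *. rewrite IH. ring. Qed.

Lemma psum_add (f : nat -> R) (r s : nat) :
  psum f (r + s) = psum f r + psum (fun d => f (r + d)%nat) s.
Proof.
  induction s as [|s IH]; [rewrite Nat.add_0_r; cbn; ring|].
  rewrite Nat.add_succ_r. cbn. rewrite IH. ring.
Qed.

Lemma psum_rev (f : nat -> R) (n : nat) : psum (fun d => f (n - d)%nat) (S n) = psum f (S n).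
Proof.
  induction n as [|n IH]; [reflexivity|].
  rewrite psum_head.
  rewrite (psum_ext _ (fun d => f (n - d)%nat)) by (intros; f_equal; lia).
  rewrite IH. change (psum f (S (S n))) with (psum f (S n) + f (S n)).
  rewrite Nat.sub_0_r. ring.
Qed.

Section Counting.

Context {c : Z -> R} (h : hierarchy c) (x : R) (Hx : forall n, Rabs (x - c n) <= 5)
  (u : Z -> R) (Hu : recurrence c x u (fun _ => 0)).

Lemma long_length_lt (k : nat) : (long_length k < long_length (S k))%Z.
Proof. rewrite long_length_S. assert (P := block_lengths_pos k). lia. Qed.

Lemma long_length_mono (k j : nat) : (k <= j)%nat -> (long_length k <= long_length j)%Z.
Proof.
  intro L. induction L as [|j L IH]; [lia|]. assert (H := long_length_lt j). lia.
Qed.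

Lemma short_length_ge_2 (k : nat) : (2 <= short_length (S (S k)))%Z.
Proof.
  rewrite short_length_S. assert (H := long_length_lt k).
  assert (P := block_lengths_pos k). lia.
Qed.

Lemma double_long_length (k : nat) : (2 * long_length k < long_length (S (S k)))%Z.
Proof.
  rewrite long_length_S, short_length_S. assert (H := long_length_lt k). lia.
Qed.

(** Each unit of [M] takes six levels: [square_end] uses four of them, and two more make room for
    twice the length. The offsets [d] found for different units thus lie in disjoint ranges and
    contribute different terms. *)
Lemma bounded_traces_count (M n : nat) :
  (forall j, (j <= 6 * M)%nat -> Rabs (long_trace x j) <= 200) ->
  (long_length (6 * M + 2) <= Z.of_nat n)%Z ->
  INR M * norm2 u (Z.of_nat n) ^ 2
  <= 201 ^ 2 * psum (fun d => norm2 u (Z.of_nat n - Z.of_nat d) ^ 2) (long_len (6 * M + 2)).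
Proof.
  intro HX. set (f := fun d => norm2 u (Z.of_nat n - Z.of_nat d) ^ 2).
  assert (Hf : forall d, 0 <= f d) by (intro d; apply pow2_ge_0).
  induction M as [|M IH]; intro Hn.
  - assert (H := psum_pos f (long_len (6 * 0 + 2)) Hf). cbn [INR]. lra.
  - assert (L6 : (6 * M + 2 <= 6 * S M + 2)%nat) by lia.
    assert (H0 := long_length_mono _ _ L6).
    assert (IH' := IH ltac:(intros; apply HX; lia) ltac:(lia)). clear IH.
    replace (6 * M + 2)%nat with (S (S (6 * M))) in * by lia.
    destruct (square_end h x _ (Z.of_nat n) (short_length_ge_2 (6 * M))) as [j [Hj Hs]].
    assert (J1 := long_length_mono _ j (proj1 Hj)).
    assert (J2 := double_long_length j).
    assert (J3 := long_length_mono (S (S j)) (6 * S M + 2) ltac:(lia)).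
    assert (J0 := block_lengths_pos j).
    assert (F := square_forward x Hx u _ Hu j _ 200 Hs ltac:(lia) ltac:(reflexivity)
      (HX j ltac:(lia))).
    replace (Z.of_nat n - long_length j + long_length j)%Z with (Z.of_nat n) in F by lia.
    (* Here [201 = 200 + 1]: if the norm at distance one period is below 1/201 of that at [n], then
       [square_forward] leaves at least 1/201 at distance two periods. *)
    assert (Q : exists d, (long_len (S (S (6 * M))) <= d < long_len (6 * S M + 2))%nat
      /\ norm2 u (Z.of_nat n) <= 201 * norm2 u (Z.of_nat n - Z.of_nat d)).
    { unfold long_len.
      destruct (Rle_dec (norm2 u (Z.of_nat n)) (201 * norm2 u (Z.of_nat n - long_length j))).
      - exists (long_len j). rewrite long_len_Z. split; [|assumption].
        unfold long_len. lia.
      - exists (2 * long_len j)%nat. rewrite Nat2Z.inj_mul, long_len_Z. split.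
        + unfold long_len. lia.
        + replace (Z.of_nat n - Z.of_nat 2 * long_length j)%Z
            with (Z.of_nat n - long_length j - long_length j)%Z by lia. lra. }
    destruct Q as [d [Hd Q]].
    assert (T := psum_term f _ _ d Hf Hd).
    assert (Q2 : norm2 u (Z.of_nat n) ^ 2 <= 201 ^ 2 * f d).
    { unfold f. rewrite <- Rpow_mult_distr. apply pow_incr.
      split; [apply norm2_pos | exact Q]. }
    rewrite S_INR. lra.
Qed.

End Counting.

(** Extension by zero encodes the boundary condition [p_{-1} = 0]: the first row of the matrix then
    has the same form as all others. *)
Definition extend (u : nat -> R) (z : Z) : R :=
  if Z_lt_dec z 0 then 0 else u (Z.to_nat z).

Lemma extend_nat (u : nat -> R) (n : nat) : extend u (Z.of_nat n) = u n.
Proof.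
  unfold extend. destruct (Z_lt_dec (Z.of_nat n) 0); [lia|]. rewrite Nat2Z.id. reflexivity.
Qed.

Lemma extend_neg (u : nat -> R) (z : Z) : (z < 0)%Z -> extend u z = 0.
Proof. intro H. unfold extend. destruct (Z_lt_dec z 0); [reflexivity|lia]. Qed.

Definition jac_Z (b : nat -> R) (x : R) : Z -> R := extend (fun n => jac_p b n x).

Lemma jac_Z_nat (b : nat -> R) (x : R) (n : nat) : jac_Z b x (Z.of_nat n) = jac_p b n x.
Proof. exact (extend_nat _ n). Qed.

Lemma jac_p_SS (b : nat -> R) (x : R) (n : nat) :
  jac_p b (S (S n)) x = (x - b (S (S n))) * jac_p b (S n) x - jac_p b n x.
Proof. unfold jac_p. cbn. destruct (jac_pair b n x). reflexivity. Qed.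

Lemma jac_Z_recurrence (b : nat -> R) (c : Z -> R) (x : R) :
  (forall n, b n = c (Z.of_nat n)) -> recurrence c x (jac_Z b x) (fun _ => 0).
Proof.
  intros Hb n Hn. replace n with (Z.of_nat (S (Z.to_nat (n - 1)))) by lia.
  set (m := Z.to_nat (n - 1)). rewrite <- Hb, jac_Z_nat.
  destruct m as [|m].
  - unfold jac_Z, extend, jac_p; cbn. ring.
  - replace (Z.of_nat (S (S m)) - 1)%Z with (Z.of_nat (S m)) by lia.
    replace (Z.of_nat (S (S m)) - 2)%Z with (Z.of_nat m) by lia.
    rewrite !jac_Z_nat, jac_p_SS. ring.
Qed.

(** The factor 4 is 2 from [(p + q)^2 <= 2 p^2 + 2 q^2] times 2 because each [p_j] occurs in two
    consecutive norms. *)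
Lemma jac_K_ge (b : nat -> R) (x : R) (n D : nat) : (D <= n)%nat ->
  psum (fun d => norm2 (jac_Z b x) (Z.of_nat n - Z.of_nat d) ^ 2) D <= 4 * jac_K b n x x.
Proof.
  intro L. unfold jac_K. rewrite psum_sum_f_R0.
  pose (g := fun d => jac_p b (n - d) x * jac_p b (n - d) x).
  assert (E : psum (fun j => jac_p b j x * jac_p b j x) (S n) = psum g (S n))
    by (symmetry; exact (psum_rev (fun j => jac_p b j x * jac_p b j x) n)).
  rewrite E. clear E.
  assert (Hg : forall d, 0 <= g d) by (intro d; unfold g; nra).
  apply Rle_trans with (psum (fun d => 2 * g d + 2 * g (S d)) D).
  - apply psum_le. intros d Hd. unfold norm2, g.
    replace (Z.of_nat n - Z.of_nat d)%Z with (Z.of_nat (n - d)) by lia.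
    replace (Z.of_nat (n - d) - 1)%Z with (Z.of_nat (n - S d)) by lia.
    rewrite !jac_Z_nat.
    set (p := jac_p b (n - d) x). set (q := jac_p b (n - S d) x).
    assert (A := Rabs_mult p p). assert (B := Rabs_mult q q).
    rewrite (Rabs_right (p * p)) in A by nra. rewrite (Rabs_right (q * q)) in B by nra.
    rewrite A, B. assert (T := pow2_ge_0 (Rabs p - Rabs q)). nra.
  - rewrite psum_lin.
    assert (A := psum_mono g D (S n) Hg ltac:(lia)).
    assert (B := psum_mono g (S D) (S n) Hg ltac:(lia)).
    rewrite psum_head in B. assert (C := Hg O). lra.
Qed.

(** * Escaping traces: decay or growth *)

Fixpoint bmax (f : nat -> R) (r : nat) : R :=
  match r with O => 0 | S q => Rmax (bmax f q) (f q) end.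

Lemma bmax_ge (f : nat -> R) (r d : nat) : (d < r)%nat -> f d <= bmax f r.
Proof.
  induction r as [|r IH]; [lia|]. intro L. cbn.
  destruct (Nat.eq_dec d r) as [->|]; [apply Rmax_r|].
  apply Rle_trans with (bmax f r); [apply IH; lia | apply Rmax_l].
Qed.

Lemma bmax_le (f : nat -> R) (r : nat) (B : R) : 0 <= B ->
  (forall d, (d < r)%nat -> f d <= B) -> bmax f r <= B.
Proof.
  intros HB. induction r as [|r IH]; intro H; cbn; [exact HB|].
  apply Rmax_lub; [apply IH; intros; apply H; lia | apply H; lia].
Qed.

Lemma bmax_pos (f : nat -> R) (r : nat) : 0 <= bmax f r.
Proof.
  induction r as [|r IH]; cbn; [lra|].
  apply Rle_trans with (bmax f r); [exact IH | apply Rmax_l].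
Qed.

Definition block_max (u : Z -> R) (P j : nat) : R :=
  bmax (fun d => norm2 u (Z.of_nat (j * P + d))) P.

Lemma block_max_ge (u : Z -> R) (P j : nat) (m : Z) :
  (Z.of_nat (j * P) <= m < Z.of_nat (j * P + P))%Z -> norm2 u m <= block_max u P j.
Proof.
  intro H. set (d := (Z.to_nat m - j * P)%nat).
  replace m with (Z.of_nat (j * P + d)) by lia.
  apply (bmax_ge (fun d => norm2 u (Z.of_nat (j * P + d)))). lia.
Qed.

(** The block length exceeds the reach of [escape_bound], so both points found there stay in the
    three neighbouring blocks. [C] precedes [u] and [v], since the estimate serves both the
    polynomials and all l^2 vectors. *)
Lemma block_max_contract {c : Z -> R} (h : hierarchy c) (x : R) (k : nat) :
  (forall n, Rabs (x - c n) <= 5) -> (2 <= short_length k)%Z ->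
  200 <= Rabs (long_trace x k) -> 200 <= Rabs (long_trace x (S k)) ->
  exists C, 0 <= C /\ forall u v, recurrence c x u v -> forall j w, 0 <= w ->
    let P := (long_len (S k) + 2)%nat in
    (forall i, (Z.of_nat (j * P) <= i < Z.of_nat (S (S (S j)) * P))%Z -> Rabs (v i) <= w) ->
    block_max u P (S j)
    <= 6 / 100 * (block_max u P j + block_max u P (S j) + block_max u P (S (S j))) + C * w.
Proof.
  intros Hx H2 T1 T2.
  exists (1 + square_const (long_len k) + square_const (long_len (S k))).
  assert (S1 := square_const_pos (long_len k)).
  assert (S2 := square_const_pos (long_len (S k))). split; [lra|].
  intros u v Hu j w Hw P Hv. set (C := 1 + _ + _) in *.
  assert (V0 := bmax_pos (fun d => norm2 u (Z.of_nat (j * P + d))) P).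
  assert (V1 := bmax_pos (fun d => norm2 u (Z.of_nat (S j * P + d))) P).
  assert (V2 := bmax_pos (fun d => norm2 u (Z.of_nat (S (S j) * P + d))) P).
  fold (block_max u P j) in V0. fold (block_max u P (S j)) in V1.
  fold (block_max u P (S (S j))) in V2.
  apply bmax_le; [assert (0 <= C * w) by (apply Rmult_le_pos; unfold C; lra); lra|].
  intros d Hd. set (m := Z.of_nat (S j * P + d)).
  assert (EP : Z.of_nat P = (long_length (S k) + 2)%Z)
    by (unfold P; rewrite Nat2Z.inj_add, long_len_Z; reflexivity).
  assert (LP := block_lengths_pos (S k)).
  assert (Near : forall i, (m - long_length (S k) <= i <= m + long_length (S k) + 1)%Z ->
     (Z.of_nat (j * P) <= i < Z.of_nat (S (S (S j)) * P))%Z) by (unfold m; lia).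
  destruct (escape_bound h x Hx u v Hu k m w H2 T1 T2 ltac:(unfold m; lia) Hw
    ltac:(intros i Hi; apply Hv, Near, Hi)) as [m1 [m2 [M1 [M2 B]]]].
  fold C in B.
  assert (N : forall i, (Z.of_nat (j * P) <= i < Z.of_nat (S (S (S j)) * P))%Z ->
    norm2 u i <= block_max u P j + block_max u P (S j) + block_max u P (S (S j))).
  { intros i Hi.
    destruct (Z_lt_ge_dec i (Z.of_nat (S j * P))).
    { assert (G := block_max_ge u P j i ltac:(lia)). lra. }
    destruct (Z_lt_ge_dec i (Z.of_nat (S (S j) * P))).
    { assert (G := block_max_ge u P (S j) i ltac:(lia)). lra. }
    assert (G := block_max_ge u P (S (S j)) i ltac:(lia)). lra. }
  assert (N1 := N m1 (Near _ M1)). assert (N2 := N m2 (Near _ M2)). lra.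
Qed.

(** Once [V (S j)] exceeds half of [V j], the inequality gives [V (S (S j)) >= (94/6 - 2) V (S j)]:
    the sequence more than doubles, and the same situation recurs one step later. *)
Lemma decay_or_growth (V : nat -> R) : (forall j, 0 <= V j) ->
  (forall j, V (S j) <= 6 / 100 * (V j + V (S j) + V (S (S j)))) ->
  (forall j, V j <= (1 / 2) ^ j * V O) \/ (forall B, exists j, B <= V j).
Proof.
  intros HV HC.
  destruct (classic (forall j, V (S j) <= 1 / 2 * V j)) as [D|D].
  - left. induction j as [|j IH]; cbn; [lra|]. assert (Dj := D j). lra.
  - right. apply not_all_ex_not in D. destruct D as [j0 D]. apply Rnot_le_lt in D.
    assert (P0 := HV j0).
    assert (G : forall i, 1 / 2 * V (j0 + i)%nat < V (S (j0 + i))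
                          /\ 2 ^ i * V (S j0) <= V (S (j0 + i))).
    { induction i as [|i [I1 I2]].
      - rewrite Nat.add_0_r. cbn [pow]. lra.
      - rewrite Nat.add_succ_r. assert (HCi := HC (j0 + i)%nat).
        assert (Hi := HV (j0 + i)%nat). cbn [pow].
        split; [|rewrite Rmult_assoc]; lra. }
    intro B. destruct (Pow_x_infinity 2 ltac:(rewrite Rabs_right; lra) (B / V (S j0))) as [i Hi].
    exists (S (j0 + i)). destruct (G i) as [_ Gi]. assert (Q := Hi i ltac:(lia)).
    rewrite Rabs_right in Q by (assert (W := pow_le 2 i); lra).
    apply Rge_le in Q.
    apply (Rmult_le_compat_r (V (S j0))) in Q; [|lra].
    unfold Rdiv in Q. rewrite Rmult_assoc, Rinv_l in Q by lra. lra.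
Qed.

(** * Bounded below implies invertible *)

Lemma sqnorm_cv (u : nat -> R) (l : R) : sqnorm_is u l <->
  forall eps, eps > 0 -> exists N, forall r, (N <= r)%nat ->
    Rabs (psum (fun k => u k ^ 2) r - l) < eps.
Proof.
  unfold sqnorm_is, infinite_sum, Rdist. split; intros H eps He; destruct (H eps He) as [N HN].
  - exists (S N). intros r Hr. replace r with (S (r - 1)) by lia.
    rewrite <- psum_sum_f_R0. apply HN. lia.
  - exists N. intros n Hn. rewrite psum_sum_f_R0. apply HN. lia.
Qed.

Lemma sqnorm_psum_le (u : nat -> R) (l : R) (r : nat) : sqnorm_is u l ->
  psum (fun k => u k ^ 2) r <= l.
Proof.
  intro H. rewrite sqnorm_cv in H. apply Rnot_lt_le. intro L.
  destruct (H (psum (fun k => u k ^ 2) r - l) ltac:(lra)) as [N HN].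
  assert (A := HN (max N r) ltac:(lia)).
  assert (B := psum_mono (fun k => u k ^ 2) r (max N r) ltac:(intro; apply pow2_ge_0) ltac:(lia)).
  rewrite Rabs_right in A; lra.
Qed.

Lemma sqnorm_le (u : nat -> R) (l B : R) : sqnorm_is u l ->
  (forall r, psum (fun k => u k ^ 2) r <= B) -> l <= B.
Proof.
  intros H HB. apply Rnot_lt_le. intro L. rewrite sqnorm_cv in H.
  destruct (H (l - B) ltac:(lra)) as [N HN].
  assert (A := HN N ltac:(lia)). assert (HBN := HB N).
  apply Rabs_def2 in A. lra.
Qed.

Lemma sqnorm_pos (u : nat -> R) (l : R) : sqnorm_is u l -> 0 <= l.
Proof. intro H. exact (sqnorm_psum_le u l 0 H). Qed.

(** Single entries are included because they make up the boundary term of [shifted_green]. *)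
Lemma sqnorm_tail (u : nat -> R) (l eps : R) : sqnorm_is u l -> 0 < eps ->
  exists N, forall r, (N <= r)%nat ->
    l - eps < psum (fun k => u k ^ 2) r /\ u r ^ 2 < eps.
Proof.
  intros H He. assert (H' := H). rewrite sqnorm_cv in H'.
  destruct (H' eps He) as [N HN]. exists N. intros r Hr.
  assert (A := HN r Hr). assert (B := sqnorm_psum_le u l (S r) H).
  apply Rabs_def2 in A. cbn [psum] in B. lra.
Qed.

Lemma in_l2_bounded (u : nat -> R) (B : R) :
  (forall r, psum (fun k => u k ^ 2) r <= B) -> in_l2 u.
Proof.
  intro HB. destruct (Un_cv_crit (fun n => sum_f_R0 (fun k => u k ^ 2) n)) as [l Hl].
  - intro n. cbn [sum_f_R0]. assert (P := pow2_ge_0 (u (S n))). lra.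
  - exists B. intros y [n ->]. rewrite psum_sum_f_R0. apply HB.
  - exists l. exact Hl.
Qed.

Lemma in_l2_lin (u v : nat -> R) (s : R) : in_l2 u -> in_l2 v ->
  in_l2 (fun k => u k + s * v k).
Proof.
  intros [lu Hu] [lv Hv]. apply in_l2_bounded with (2 * lu + 2 * s ^ 2 * lv). intro r.
  apply Rle_trans with (psum (fun k => 2 * u k ^ 2 + 2 * s ^ 2 * v k ^ 2) r).
  - apply psum_le. intros k _. assert (P := pow2_ge_0 (u k - s * v k)). nra.
  - rewrite (psum_lin (fun k => u k ^ 2) (fun k => v k ^ 2)).
    assert (A := sqnorm_psum_le u lu r Hu). assert (B := sqnorm_psum_le v lv r Hv).
    assert (C := pow2_ge_0 s). apply Rplus_le_compat; apply Rmult_le_compat_l; lra.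
Qed.

Definition shifted (b : nat -> R) (x : R) (u : nat -> R) (k : nat) : R :=
  jac_apply b u k - x * u k.

Section Operator.

Context (b : nat -> R) (x D : R) (HD : forall k, Rabs (b (S k) - x) <= D).

Lemma shifted_lin (u v w : nat -> R) (s : R) : (forall k, w k = u k + s * v k) ->
  forall k, shifted b x w k = shifted b x u k + s * shifted b x v k.
Proof. intros H [|k]; unfold shifted, jac_apply; rewrite !H; ring. Qed.

Lemma shifted_bound (u : nat -> R) (r : nat) :
  psum (fun k => shifted b x u k ^ 2) r
  <= 3 * (2 + D ^ 2) * psum (fun k => u k ^ 2) (S r).
Proof.
  pose (prev := fun k => match k with O => 0 | S j => u j ^ 2 end).
  pose (sq := fun k => u k ^ 2).
  assert (Hsq : forall k, 0 <= sq k) by (intro; apply pow2_ge_0).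
  assert (Hprev : forall k, 0 <= prev k) by (intros [|k]; cbn; [lra | apply (Hsq k)]).
  apply Rle_trans with
    (psum (fun k => 1 * (3 * prev k + 3 * D ^ 2 * sq k) + 3 * sq (S k)) r).
  - apply psum_le. intros k _.
    assert (Q : (b (S k) - x) ^ 2 * u k ^ 2 <= D ^ 2 * u k ^ 2).
    { apply Rmult_le_compat_r; [apply pow2_ge_0|].
      rewrite <- (pow2_abs (b (S k) - x)). apply pow_incr. split; [apply Rabs_pos | apply HD]. }
    assert (T : forall p q t, (p + q + t) ^ 2 <= 3 * (p ^ 2 + q ^ 2 + t ^ 2)).
    { intros p q t. assert (A := pow2_ge_0 (p - q)). assert (B := pow2_ge_0 (q - t)).
      assert (C := pow2_ge_0 (p - t)). nra. }
    rewrite <- Rpow_mult_distr in Q.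
    destruct k as [|k]; unfold shifted, jac_apply, prev, sq.
    + assert (T0 := T 0 ((b 1%nat - x) * u 0%nat) (u 1%nat)).
      replace (b 1%nat * u 0%nat + u 1%nat - x * u 0%nat)
        with (0 + (b 1%nat - x) * u 0%nat + u 1%nat) by ring. lra.
    + assert (T0 := T (u k) ((b (S (S k)) - x) * u (S k)) (u (S (S k)))).
      replace (u k + b (S (S k)) * u (S k) + u (S (S k)) - x * u (S k))
        with (u k + (b (S (S k)) - x) * u (S k) + u (S (S k))) by ring. lra.
  - rewrite psum_lin, psum_lin.
    assert (A : psum prev r <= psum sq (S r)).
    { apply Rle_trans with (psum prev (S r)); [apply psum_mono; trivial; lia|].
      rewrite psum_head. change (psum (fun d => prev (S d)) r) with (psum sq r).
      assert (P := psum_mono sq r (S r) Hsq ltac:(lia)). cbn [prev]. lra. }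
    assert (B := psum_mono sq r (S r) Hsq ltac:(lia)).
    assert (C := psum_head sq r). assert (C0 := Hsq O).
    assert (E : D ^ 2 * psum sq r <= D ^ 2 * psum sq (S r))
      by (apply Rmult_le_compat_l; [apply pow2_ge_0 | exact B]).
    fold sq. lra.
Qed.

Lemma in_l2_shifted (u : nat -> R) : in_l2 u -> in_l2 (shifted b x u).
Proof.
  intros [l Hl]. apply in_l2_bounded with (3 * (2 + D ^ 2) * l). intro r.
  apply Rle_trans with (1 := shifted_bound u r).
  apply Rmult_le_compat_l; [assert (P := pow2_ge_0 D); lra|].
  apply sqnorm_psum_le, Hl.
Qed.

(** Green's identity: truncation breaks the symmetry of the operator only by a discrete
    Wronskian. *)
Lemma shifted_green (z y : nat -> R) (r : nat) :
  psum (fun k => z k * shifted b x y k) (S r)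
  = psum (fun k => shifted b x z k * y k) (S r) + (z r * y (S r) - z (S r) * y r).
Proof.
  induction r as [|r IH].
  - cbn. unfold shifted, jac_apply. ring.
  - cbn [psum] in *. rewrite IH. unfold shifted, jac_apply. ring.
Qed.

Lemma shifted_cv (w : nat -> nat -> R) (W : nat -> R) :
  (forall k, Un_cv (fun n => w n k) (W k)) ->
  forall k, Un_cv (fun n => shifted b x (w n) k) (shifted b x W k).
Proof.
  intros H k.
  assert (Hc : forall a j, Un_cv (fun n => a * w n j) (a * W j)).
  { intros a j. apply (CV_mult (fun _ => a) (fun n => w n j)); [|apply H].
    intros eps He. exists O. intros. rewrite Rdist_eq. exact He. }
  destruct k as [|k]; unfold shifted, jac_apply.
  - apply (CV_minus (fun n => b 1%nat * w n 0%nat + w n 1%nat) (fun n => x * w n 0%nat));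
      [|apply Hc].
    apply (CV_plus (fun n => b 1%nat * w n 0%nat)); [apply Hc | apply H].
  - apply (CV_minus (fun n => w n k + b (S (S k)) * w n (S k) + w n (S (S k)))
      (fun n => x * w n (S k))); [|apply Hc].
    apply (CV_plus (fun n => w n k + b (S (S k)) * w n (S k))); [|apply H].
    apply (CV_plus (fun n => w n k)); [apply H | apply Hc].
Qed.

End Operator.

Lemma psum_cv (w : nat -> nat -> R) (W : nat -> R) (r : nat) :
  (forall k, Un_cv (fun n => w n k) (W k)) ->
  Un_cv (fun n => psum (fun k => w n k ^ 2) r) (psum (fun k => W k ^ 2) r).
Proof.
  intro H. induction r as [|r IH]; cbn [psum].
  - intros eps He. exists O. intros. rewrite Rdist_eq. exact He.
  - apply (CV_plus (fun n => psum (fun k => w n k ^ 2) r) (fun n => w n r ^ 2)); [exact IH|].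
    cbn [pow]. assert (C1 : Un_cv (fun _ : nat => 1) 1)
      by (intros eps He; exists O; intros; rewrite Rdist_eq; exact He).
    apply (CV_mult (fun n => w n r) (fun n => w n r * 1)); [apply H|].
    apply (CV_mult (fun n => w n r) (fun _ => 1)); [apply H | exact C1].
Qed.

Lemma Un_cv_le (a : nat -> R) (l B : R) : Un_cv a l -> (forall n, a n <= B) -> l <= B.
Proof.
  intros H HB. apply Rnot_lt_le. intro L. destruct (H (l - B) ltac:(lra)) as [N HN].
  assert (A := HN N ltac:(lia)). unfold Rdist in A. apply Rabs_def2 in A.
  assert (HBN := HB N). lra.
Qed.

Section Neumann.

Context (b : nat -> R) (x D : R) (HD : forall k, Rabs (b (S k) - x) <= D).

Notation H := (shifted b x).

Definition neumann_step : R := / (3 * (2 + D ^ 2)).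

Lemma neumann_step_pos : 0 < neumann_step.
Proof. apply Rinv_0_lt_compat. assert (P := pow2_ge_0 D). lra. Qed.

(** By symmetry the square expands to [|z|^2 - 2 s |H z|^2 + s^2 |H H z|^2], and the choice
    [s |H|^2 <= 1] lets half of the middle term absorb the last. *)
Lemma neumann_contract (z : nat -> R) (lz ly lw : R) :
  sqnorm_is z lz -> sqnorm_is (H z) ly ->
  sqnorm_is (fun k => z k + - neumann_step * H (H z) k) lw ->
  lw <= lz - neumann_step * ly.
Proof.
  intros Hz Hy Hw. assert (SP := neumann_step_pos). set (s := neumann_step) in *.
  apply Rle_plus_epsilon. intros eps He.
  (* The mixed term has coefficient [2 s] and an error of at most [3 e]: one [e] from the tail of
     [H z], two from the Wronskian. *)
  set (e := eps / (6 * s)).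
  assert (e0 : 0 < e) by (apply Rdiv_lt_0_compat; lra).
  assert (es : 6 * s * e = eps) by (unfold e; field; lra).
  destruct (sqnorm_tail z lz e Hz e0) as [N1 T1].
  destruct (sqnorm_tail (H z) ly e Hy e0) as [N2 T2].
  assert (Tail : forall r, (max N1 N2 <= r)%nat ->
    psum (fun k => (z k + - s * H (H z) k) ^ 2) (S r) <= lz - s * ly + eps).
  { intros r Hr.
    rewrite (psum_ext _ (fun k => 1 * (1 * z k ^ 2 + (- (2 * s)) * (z k * H (H z) k))
      + s ^ 2 * H (H z) k ^ 2)) by (intros; ring).
    rewrite psum_lin, psum_lin, shifted_green.
    assert (A := sqnorm_psum_le z lz (S r) Hz).
    assert (B := shifted_bound b x D HD (H z) (S r)).
    assert (B' := sqnorm_psum_le _ ly (S (S r)) Hy).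
    assert (M : s * (3 * (2 + D ^ 2)) = 1)
      by (unfold s, neumann_step; assert (P := pow2_ge_0 D); field; lra).
    assert (C : s ^ 2 * psum (fun k => H (H z) k ^ 2) (S r) <= s * ly).
    { apply Rle_trans with (s ^ 2 * (3 * (2 + D ^ 2) * ly)).
      - apply Rmult_le_compat_l; [apply pow2_ge_0|]. apply Rle_trans with (1 := B).
        apply Rmult_le_compat_l; [assert (P := pow2_ge_0 D); lra | exact B'].
      - replace (s ^ 2 * (3 * (2 + D ^ 2) * ly))
          with (s * (s * (3 * (2 + D ^ 2))) * ly) by ring. rewrite M. lra. }
    rewrite (psum_ext (fun k => H z k * H z k) (fun k => H z k ^ 2)) by (intros; ring).
    destruct (T1 r ltac:(lia)) as [_ Z1]. destruct (T1 (S r) ltac:(lia)) as [_ Z2].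
    destruct (T2 r ltac:(lia)) as [_ Y1]. destruct (T2 (S r) ltac:(lia)) as [Q Y2].
    assert (Am : forall p q, p ^ 2 < e -> q ^ 2 < e -> - e < p * q < e)
      by (intros p q Hp Hq; split;
          [assert (W := pow2_ge_0 (p + q)) | assert (W := pow2_ge_0 (p - q))]; nra).
    assert (A1 := Am _ _ Z1 Y2). assert (A2 := Am _ _ Z2 Y1).
    set (S2 := psum (fun k => H z k ^ 2) (S r)) in *.
    set (bd := z r * H z (S r) - z (S r) * H z r).
    assert (F : s * (ly - 3 * e) <= s * (S2 + bd))
      by (apply Rmult_le_compat_l; [lra | unfold bd; lra]).
    lra. }
  apply sqnorm_le with (1 := Hw). intro r.
  apply Rle_trans with (2 := Tail (max r (max N1 N2)) ltac:(lia)).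
  apply psum_mono; [intro; apply pow2_ge_0 | lia].
Qed.

Context (C : R) (HC : 0 < C) (HB : forall u lu lv, in_l2 u -> sqnorm_is u lu ->
  sqnorm_is (H u) lv -> lu <= C * lv).

Fixpoint residual (v : nat -> R) (n : nat) : nat -> R :=
  match n with
  | O => v
  | S m => fun k => residual v m k + - neumann_step * H (H (residual v m)) k
  end.

Definition neumann_sum (v : nat -> R) (n k : nat) : R :=
  neumann_step * psum (fun i => residual v i k) n.

Lemma residual_l2 (v : nat -> R) (n : nat) : in_l2 v -> in_l2 (residual v n).
Proof.
  intro Hv. induction n as [|n IH]; cbn [residual]; [exact Hv|].
  apply in_l2_lin; [exact IH|]. do 2 apply (in_l2_shifted b x D HD). exact IH.
Qed.

Lemma neumann_sum_l2 (v : nat -> R) (n : nat) : in_l2 v -> in_l2 (neumann_sum v n).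
Proof.
  intro Hv. unfold neumann_sum. induction n as [|n IH]; cbn [psum].
  - apply in_l2_bounded with 0. intro r. apply Req_le.
    rewrite (psum_ext _ (fun _ => 0 * 0 + 0 * 0)) by (intros; ring).
    rewrite (psum_lin (fun _ => 0) (fun _ => 0)). ring.
  - assert (L := in_l2_lin _ _ neumann_step IH (residual_l2 v n Hv)).
    destruct L as [l Hl]. exists l. revert Hl. unfold sqnorm_is, infinite_sum.
    intros Hl eps He. destruct (Hl eps He) as [N HN]. exists N. intros m Hm.
    rewrite (sum_eq _ (fun k => (neumann_step * psum (fun i => residual v i k) n
      + neumann_step * residual v n k) ^ 2)) by (intros; ring).
    apply HN, Hm.
Qed.

Lemma neumann_residual (v : nat -> R) (n k : nat) :
  H (H (neumann_sum v n)) k = v k + - residual v n k.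
Proof.
  revert k. induction n as [|n IH]; intro k.
  - assert (Z : forall w, (forall j, w j = 0) -> forall j, H w j = 0)
      by (intros w Hw [|j]; unfold shifted, jac_apply; rewrite !Hw; ring).
    rewrite Z; [cbn; ring|]. apply Z. intro j. unfold neumann_sum. cbn. ring.
  - rewrite (shifted_lin b x (H (neumann_sum v n)) (H (residual v n)) _ neumann_step).
    + rewrite IH. cbn [residual]. ring.
    + apply shifted_lin. intro j. unfold neumann_sum. cbn [psum]. ring.
Qed.

Lemma residual_decay (v : nat -> R) (lv : R) : sqnorm_is v lv ->
  exists q, 0 <= q < 1 /\ forall n l, sqnorm_is (residual v n) l -> l <= q ^ n * lv.
Proof.
  intro Hv. assert (SP := neumann_step_pos).
  (* The lower bound turns the gain [s |H z|^2] into [(s / C) |z|^2]; the minimum with 1 keeps the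
     ratio nonnegative. *)
  exists (1 - Rmin 1 (neumann_step / C)).
  assert (E1 : 0 < Rmin 1 (neumann_step / C))
    by (apply Rmin_glb_lt; [lra | apply Rdiv_lt_0_compat; lra]).
  assert (E2 := Rmin_l 1 (neumann_step / C)). assert (E3 := Rmin_r 1 (neumann_step / C)).
  set (d := Rmin 1 (neumann_step / C)) in *. split; [lra|].
  assert (E3' : d * C <= neumann_step).
  { apply (Rmult_le_compat_r C) in E3; [|lra]. unfold Rdiv in E3.
    rewrite Rmult_assoc, Rinv_l, Rmult_1_r in E3 by lra. exact E3. }
  induction n as [|n IH]; intros l Hl.
  - cbn [pow]. assert (l <= lv); [|lra].
    apply sqnorm_le with (1 := Hl). intro r. apply sqnorm_psum_le, Hv.
  - assert (L2 := residual_l2 v n ltac:(exists lv; exact Hv)).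
    assert (L2' := in_l2_shifted b x D HD _ L2).
    assert (L2c := L2). destruct L2c as [lz Hz]. destruct L2' as [ly Hy].
    assert (K := neumann_contract _ lz ly l Hz Hy Hl).
    assert (B := HB _ lz ly L2 Hz Hy). assert (I := IH lz Hz).
    assert (Y := sqnorm_pos _ _ Hy).
    assert (d * lz <= neumann_step * ly).
    { apply Rle_trans with (d * (C * ly)); [apply Rmult_le_compat_l; lra|].
      rewrite <- Rmult_assoc. apply Rmult_le_compat_r; lra. }
    cbn [pow]. apply Rle_trans with ((1 - d) * lz); [lra|].
    rewrite Rmult_assoc. apply Rmult_le_compat_l; lra.
Qed.

(** Every coordinate is bounded by the l^2 norm. The series therefore converges coordinate by
    coordinate, which takes the place of completeness of l^2. *)
Lemma residual_pointwise (v : nat -> R) : in_l2 v ->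
  exists q A, 0 <= q < 1 /\ forall n k, Rabs (residual v n k) <= q ^ n * A.
Proof.
  intros [lv Hv]. destruct (residual_decay v lv Hv) as [q [Hq Hd]].
  exists (sqrt q), (sqrt lv). split.
  { split; [apply sqrt_pos|]. rewrite <- sqrt_1. apply sqrt_lt_1; lra. }
  intros n k. destruct (residual_l2 v n ltac:(exists lv; exact Hv)) as [l Hl].
  assert (A := Hd n l Hl). assert (B := sqnorm_psum_le _ l (S k) Hl).
  assert (P := psum_pos (fun k => residual v n k ^ 2) k ltac:(intro; apply pow2_ge_0)).
  cbn [psum] in B. assert (L := sqnorm_pos _ _ Hv).
  apply Rsqr_incr_0_var; [|apply Rmult_le_pos; [apply pow_le|]; apply sqrt_pos].
  rewrite <- Rsqr_abs. unfold Rsqr.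
  replace (sqrt q ^ n * sqrt lv * (sqrt q ^ n * sqrt lv))
    with ((sqrt q * sqrt q) ^ n * (sqrt lv * sqrt lv)) by (rewrite Rpow_mult_distr; ring).
  rewrite !sqrt_sqrt by lra. cbn [pow] in B, P. lra.
Qed.

(** For the coordinatewise limit [z] of the Neumann sums, [H (H z) = v], so [H z] is the preimage.
    It lies in l^2 because the lower bound controls [H] of each Neumann sum by [v] minus a residual,
    of squared norm at most [4 lv], and this passes to the limit in partial sums. *)
Lemma bounded_below_resolvent : in_resolvent b x.
Proof.
  split; [|exists C; exact HB].
  intros v Hv. destruct (residual_pointwise v Hv) as [q [A [Hq HA]]].
  assert (Hlim : forall k, {z : R | Un_cv (fun n => neumann_sum v n k) z}).
  { intro k. assert (Ex : ex_series (fun n => residual v n k)).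
    { apply (ex_series_le (fun n => residual v n k) (fun n => q ^ n * A));
        [intro n; exact (HA n k)|].
      apply ex_series_scal_r. apply ex_series_geom. rewrite Rabs_right; lra. }
    apply ex_series_Reals_0 in Ex. destruct Ex as [l Hl].
    exists (neumann_step * l). unfold neumann_sum.
    apply (CV_mult (fun _ => neumann_step) (fun n => psum (fun i => residual v i k) n)).
    - intros eps He. exists O. intros. rewrite Rdist_eq. exact He.
    - intros eps He. destruct (Hl eps He) as [N HN]. exists (S N). intros n Hn.
      replace n with (S (n - 1)) by lia. rewrite <- psum_sum_f_R0. apply HN. lia. }
  pose (z := fun k => proj1_sig (Hlim k)).
  assert (Hz : forall k, Un_cv (fun n => neumann_sum v n k) (z k))
    by (intro k; exact (proj2_sig (Hlim k))).
  assert (Hz1 := shifted_cv b x _ _ Hz). assert (Hz2 := shifted_cv b x _ _ Hz1).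
  exists (H z). split.
  - destruct Hv as [lv Hv].
    destruct (residual_decay v lv Hv) as [q' [Hq' Hd]].
    apply in_l2_bounded with (C * (4 * lv)). intro r.
    apply Un_cv_le with (1 := psum_cv (fun n => H (neumann_sum v n)) (H z) r Hz1).
    intro n. assert (L := neumann_sum_l2 v n ltac:(exists lv; exact Hv)).
    apply (in_l2_shifted b x D HD) in L.
    assert (L' := in_l2_shifted b x D HD _ L). assert (Lc := L).
    destruct Lc as [l1 H1]. destruct L' as [l2 H2].
    apply Rle_trans with l1; [apply sqnorm_psum_le, H1|].
    apply Rle_trans with (1 := HB _ l1 l2 L H1 H2).
    apply Rmult_le_compat_l; [lra|]. apply sqnorm_le with (1 := H2). intro m.
    rewrite (psum_ext _ (fun k => (v k + - residual v n k) ^ 2))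
      by (intros; rewrite neumann_residual; reflexivity).
    apply Rle_trans with (psum (fun k => 2 * v k ^ 2 + 2 * residual v n k ^ 2) m).
    + apply psum_le. intros k _. assert (P := pow2_ge_0 (v k + residual v n k)). nra.
    + rewrite (psum_lin (fun k => v k ^ 2) (fun k => residual v n k ^ 2)).
      destruct (residual_l2 v n ltac:(exists lv; exact Hv)) as [l Hl].
      assert (B1 := sqnorm_psum_le _ _ m Hv). assert (B2 := sqnorm_psum_le _ _ m Hl).
      assert (B3 := Hd n l Hl). assert (B4 := sqnorm_pos _ _ Hv).
      assert (B5 : q' ^ n * lv <= 1 * lv).
      { apply Rmult_le_compat_r; [exact B4|]. rewrite <- (pow1 n). apply pow_incr. lra. }
      lra.
  - intro k. change (H (H z) k = v k). apply UL_sequence with (1 := Hz2 k).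
    assert (P : Un_cv (fun n => q ^ n * A) 0).
    { replace 0 with (0 * A) by ring.
      apply (CV_mult (fun n => q ^ n) (fun _ => A)).
      - intros eps He.
        destruct (pow_lt_1_zero q ltac:(rewrite Rabs_right; lra) eps He) as [N HN].
        exists N. intros n Hn. unfold Rdist. rewrite Rminus_0_r. apply HN, Hn.
      - intros eps He. exists O. intros. rewrite Rdist_eq. exact He. }
    intros eps He. destruct (P eps He) as [N HN]. exists N. intros n Hn.
    assert (Q := HN n Hn). unfold Rdist in *. rewrite neumann_residual.
    replace (v k + - residual v n k - v k) with (- residual v n k) by ring.
    rewrite Rabs_Ropp. apply Rle_lt_trans with (1 := HA n k).
    rewrite Rminus_0_r in Q. apply Rle_lt_trans with (2 := Q). apply Rle_abs.
Qed.

End Neumann.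

(** * Exponential growth implies invertible *)

(** [shifted_bound] at energy 0 gives [|J u|^2 <= 9 |u|^2]. With [y = (J - x) u], the inequality
    [(x u)^2 <= 3/2 (J u)^2 + 3 y^2] closes because [27/2 < 16]. *)
Lemma large_energy_resolvent (b : nat -> R) (x : R) :
  (forall k, 0 <= b k <= 1) -> 4 < Rabs x -> in_resolvent b x.
Proof.
  intros Hb Hx. apply bounded_below_resolvent with (D := 1 + Rabs x) (C := 2); [|lra|].
  { intro k. assert (B := Hb (S k)). assert (T := Rabs_triang (b (S k)) (- x)).
    rewrite Rabs_Ropp, (Rabs_right (b (S k))) in T by lra. unfold Rminus. lra. }
  intros u lu lv _ Hu Hv.
  assert (K : forall r, 16 * psum (fun k => u k ^ 2) r <= 27 / 2 * lu + 3 * lv).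
  { intro r. rewrite <- (Rplus_0_r (16 * _)), <- (Rmult_0_l (psum (fun k => u k ^ 2) r)).
    rewrite <- psum_lin.
    apply Rle_trans with
      (psum (fun k => 3 / 2 * shifted b 0 u k ^ 2 + 3 * shifted b x u k ^ 2) r).
    - apply psum_le. intros k _.
      replace (shifted b 0 u k) with (shifted b x u k + x * u k) by (unfold shifted; ring).
      set (y := shifted b x u k). set (t := x * u k).
      assert (A : 16 * u k ^ 2 <= t ^ 2).
      { unfold t. rewrite Rpow_mult_distr, <- (pow2_abs x).
        apply Rmult_le_compat_r; [apply pow2_ge_0|]. nra. }
      assert (B := pow2_ge_0 (t + 3 * y)). nra.
    - rewrite psum_lin.
      assert (A := shifted_bound b 0 1
        ltac:(intro k; assert (B := Hb (S k)); rewrite Rminus_0_r, Rabs_right; lra) u r).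
      assert (B := sqnorm_psum_le _ _ (S r) Hu). assert (C := sqnorm_psum_le _ _ r Hv).
      lra. }
  assert (lu <= 27 / 32 * lu + 3 / 16 * lv); [|assert (V0 := sqnorm_pos _ _ Hv); lra].
  apply sqnorm_le with (1 := Hu). intro r. assert (Kr := K r). lra.
Qed.

Lemma psum_blocks (f : nat -> R) (P N : nat) :
  psum (fun j => psum (fun d => f (j * P + d)%nat) P) N = psum f (N * P).
Proof.
  induction N as [|N IH]; [reflexivity|].
  cbn [psum]. rewrite IH. replace (S N * P)%nat with (N * P + P)%nat by lia.
  rewrite psum_add. reflexivity.
Qed.

Lemma bmax_scale (f : nat -> R) (r : nat) (a B : R) : 0 <= a -> 0 <= B ->
  (forall d, (d < r)%nat -> a * f d <= B) -> a * bmax f r <= B.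
Proof.
  intros Ha HB. induction r as [|r IH]; intro H; cbn; [lra|].
  apply (Rmax_case (bmax f r) (f r) (fun t => a * t <= B));
    [apply IH; intros; apply H; lia | apply H; lia].
Qed.

Section Growth.

Context {c : Z -> R} (b : nat -> R) (Hbc : forall n, b n = c (Z.of_nat n)) (x : R)
  (Hx : forall n, Rabs (x - c n) <= 5).

Lemma extend_recurrence (u : nat -> R) :
  recurrence c x (extend u) (fun z => extend (shifted b x u) (z - 1)).
Proof.
  intros n Hn. replace n with (Z.of_nat (S (Z.to_nat (n - 1)))) by lia.
  set (m := Z.to_nat (n - 1)). rewrite <- Hbc, extend_nat.
  replace (Z.of_nat (S m) - 1)%Z with (Z.of_nat m) by lia. rewrite !extend_nat.
  destruct m as [|m].
  - rewrite extend_neg by lia. unfold shifted, jac_apply. ring.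
  - replace (Z.of_nat (S (S m)) - 2)%Z with (Z.of_nat m) by lia.
    rewrite extend_nat. unfold shifted, jac_apply. ring.
Qed.

Lemma perturbation_bound (u v : Z -> R) (w : R) (m : nat) : recurrence c x u v ->
  0 <= w -> (forall i, Rabs (v i) <= w) -> norm2 u 0 = 0 ->
  norm2 u (Z.of_nat m) <= 7 ^ m * w.
Proof.
  intros Hu Hw Hv H0. induction m as [|m IH].
  - change (Z.of_nat 0) with 0%Z. rewrite H0. cbn. lra.
  - assert (S1 := proj1 (norm2_step x Hx u v Hu (Z.of_nat m) ltac:(lia))).
    replace (Z.of_nat m + 1)%Z with (Z.of_nat (S m)) in S1 by lia.
    assert (V := Hv (Z.of_nat (S m))).
    assert (P := pow_R1_Rle 7 m ltac:(lra)).
    assert (Q : 1 * w <= 7 ^ m * w) by (apply Rmult_le_compat_r; lra).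
    cbn [pow]. rewrite Rmult_assoc. lra.
Qed.

Lemma extend_sqr_le (v : nat -> R) (lv : R) (z : Z) : sqnorm_is v lv ->
  Rabs (extend v z) <= sqrt lv.
Proof.
  intro Hv. unfold extend. destruct (Z_lt_dec z 0); [rewrite Rabs_R0; apply sqrt_pos|].
  set (k := Z.to_nat z). assert (B := sqnorm_psum_le _ lv (S k) Hv).
  assert (P := psum_pos (fun k => v k ^ 2) k ltac:(intro; apply pow2_ge_0)).
  cbn [psum] in B. rewrite <- sqrt_Rsqr_abs. apply sqrt_le_1_alt. unfold Rsqr. lra.
Qed.

Context (P : nat) (HP : (0 < P)%nat) (C1 : R) (HC1 : 0 <= C1)
  (Hcontract : forall u v, recurrence c x u v -> forall j w, 0 <= w ->
    (forall i, (Z.of_nat (j * P) <= i < Z.of_nat (S (S (S j)) * P))%Z -> Rabs (v i) <= w) ->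
    block_max u P (S j)
    <= 6 / 100 * (block_max u P j + block_max u P (S j) + block_max u P (S (S j)))
       + C1 * w).

Lemma block_max_l2_vanish (u : nat -> R) (l eps : R) : sqnorm_is u l -> 0 < eps ->
  exists N, forall j, (N <= j)%nat -> block_max (extend u) P j ^ 2 <= eps.
Proof.
  intros Hu He. destruct (sqnorm_tail u l (eps / 4) Hu ltac:(lra)) as [N HN].
  exists (S N). intros j Hj.
  assert (Hk : forall k, (N <= k)%nat -> Rabs (u k) <= sqrt (eps / 4)).
  { intros k Hk. rewrite <- sqrt_Rsqr_abs. apply sqrt_le_1_alt. unfold Rsqr.
    destruct (HN k Hk). lra. }
  assert (S0 := sqrt_pos (eps / 4)).
  replace eps with ((2 * sqrt (eps / 4)) ^ 2)
    by (rewrite Rpow_mult_distr, <- (Rsqr_pow2 (sqrt _)), Rsqr_sqrt; lra).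
  apply pow_incr. split; [apply bmax_pos|]. apply bmax_le; [lra|].
  intros d _. unfold norm2.
  assert (j <= j * P)%nat by nia.
  replace (Z.of_nat (j * P + d) - 1)%Z with (Z.of_nat (j * P + d - 1)) by lia.
  rewrite !extend_nat.
  assert (A := Hk (j * P + d)%nat ltac:(lia)).
  assert (B := Hk (j * P + d - 1)%nat ltac:(lia)). lra.
Qed.

(** The squared contraction is summed over the blocks; the term at the far end vanishes in the limit
    as [u] is in l^2. Only the zeroth block is left to be controlled. *)
Lemma block_max_l2_sum (u : nat -> R) (lu lv : R) (N : nat) :
  sqnorm_is u lu -> sqnorm_is (shifted b x u) lv ->
  psum (fun j => block_max (extend u) P (S j) ^ 2) N
  <= 2 / 100 * block_max (extend u) P 0 ^ 2 + 13 * C1 ^ 2 * lv.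
Proof.
  intros Hu Hv.
  pose (Q := fun j => block_max (extend u) P j ^ 2).
  pose (f := fun i => extend (shifted b x u) (Z.of_nat i - 1) ^ 2).
  pose (B := fun j => psum (fun d => f (j * P + d)%nat) P).
  assert (Hf : forall i, 0 <= f i) by (intro; apply pow2_ge_0).
  assert (HB : forall j, 0 <= B j) by (intro; apply psum_pos; intro; apply Hf).
  assert (HQ : forall j, 0 <= Q j) by (intro; apply pow2_ge_0).
  assert (SB : forall M, psum B M <= lv).
  { intro M. unfold B. rewrite psum_blocks. set (T := (M * P)%nat).
    apply Rle_trans with (psum f (S T)); [apply psum_mono; trivial; lia|].
    rewrite psum_head. rewrite (psum_ext _ (fun k => shifted b x u k ^ 2)).
    - unfold f at 1. rewrite extend_neg by lia. assert (L := sqnorm_psum_le _ _ T Hv). lra.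
    - intros d _. unfold f. replace (Z.of_nat (S d) - 1)%Z with (Z.of_nat d) by lia.
      rewrite extend_nat. reflexivity. }
  assert (Step : forall j, Q (S j) <= 1 * (144/10000 * Q j + 144/10000 * Q (S j))
     + 1 * (144/10000 * Q (S (S j)) + 4 * C1 ^ 2 * (B j + B (S j) + B (S (S j))))).
  { intro j. set (om := B j + B (S j) + B (S (S j))).
    assert (om0 : 0 <= om) by (unfold om; assert (H1 := HB j); assert (H2 := HB (S j));
      assert (H3 := HB (S (S j))); lra).
    assert (Hw : forall i, (Z.of_nat (j * P) <= i < Z.of_nat (S (S (S j)) * P))%Z ->
       Rabs (extend (shifted b x u) (i - 1)) <= sqrt om).
    { intros i Hi. rewrite <- sqrt_Rsqr_abs. apply sqrt_le_1_alt.
      set (n := Z.to_nat i). replace i with (Z.of_nat n) by lia.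
      assert (E : Rsqr (extend (shifted b x u) (Z.of_nat n - 1)) = f n)
        by (unfold f; rewrite Rsqr_pow2; reflexivity).
      rewrite E.
      assert (T := psum_term f (j * P) (S (S (S j)) * P) n Hf ltac:(lia)).
      rewrite <- !psum_blocks in T. cbn [psum] in T. fold (B j) in T.
      fold (B (S j)) in T. fold (B (S (S j))) in T. unfold om. lra. }
    assert (K := Hcontract _ _ (extend_recurrence u) j (sqrt om) (sqrt_pos om) Hw).
    assert (V1 := bmax_pos (fun d => norm2 (extend u) (Z.of_nat (S j * P + d))) P).
    fold (block_max (extend u) P (S j)) in V1. unfold Q.
    set (v0 := block_max (extend u) P j) in *. set (v1 := block_max (extend u) P (S j)) in *.
    set (v2 := block_max (extend u) P (S (S j))) in *.
    set (y := C1 * sqrt om) in *.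
    assert (Y : y ^ 2 = C1 ^ 2 * om)
      by (unfold y; rewrite Rpow_mult_distr, <- (Rsqr_pow2 (sqrt om)), Rsqr_sqrt; lra).
    assert (K2 : v1 ^ 2 <= (6 / 100 * (v0 + v1 + v2) + y) ^ 2)
      by (apply pow_incr; split; assumption).
    replace (4 * C1 ^ 2 * om) with (4 * y ^ 2) by (rewrite Y; ring).
    set (p0 := 6 / 100 * v0) in *. set (p1 := 6 / 100 * v1) in *. set (p2 := 6 / 100 * v2) in *.
    replace (6 / 100 * (v0 + v1 + v2)) with (p0 + p1 + p2) in K2 by (unfold p0, p1, p2; ring).
    assert (T : (p0 + p1 + p2 + y) ^ 2 <= 4 * (p0 ^ 2 + p1 ^ 2 + p2 ^ 2 + y ^ 2)).
    { assert (A1 := pow2_ge_0 (p0 - p1)). assert (A2 := pow2_ge_0 (p0 - p2)).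
      assert (A3 := pow2_ge_0 (p0 - y)). assert (A4 := pow2_ge_0 (p1 - p2)).
      assert (A5 := pow2_ge_0 (p1 - y)). assert (A6 := pow2_ge_0 (p2 - y)). nra. }
    unfold p0, p1, p2 in T. unfold p0, p1, p2 in K2. lra. }
  (* Here [144/10000 = 4 (6/100)^2]. Absorbing three such terms leaves the factor 9568/10000 on the
     left, and [144/9568 < 2/100], [12/0.9568 < 13]. *)
  assert (Sum : forall M, psum (fun j => Q (S j)) M
    <= 2 / 100 * (Q O + Q (S M)) + 13 * C1 ^ 2 * lv).
  { intro M.
    assert (L := psum_le (fun j => Q (S j)) _ M (fun d _ => Step d)).
    rewrite psum_lin, psum_lin, psum_lin in L.
    assert (L3 : psum (fun j => B j + B (S j) + B (S (S j))) M <= 3 * lv).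
    { rewrite (psum_ext _ (fun j => 1 * (1 * B j + 1 * B (S j)) + 1 * B (S (S j))))
        by (intros; ring).
      rewrite psum_lin, psum_lin. assert (B0 := SB M).
      assert (B1 := SB (S M)). rewrite psum_head in B1.
      assert (B2 := SB (S (S M))). rewrite psum_head, psum_head in B2.
      assert (H0 := HB O). assert (H1 := HB 1%nat). lra. }
    assert (L4 : 4 * C1 ^ 2 * psum (fun j => B j + B (S j) + B (S (S j))) M
      <= 4 * C1 ^ 2 * (3 * lv))
      by (apply Rmult_le_compat_l; [assert (W := pow2_ge_0 C1); lra | exact L3]).
    assert (E1 := psum_head Q M). cbn [psum] in E1.
    assert (E2 := psum_head (fun j => Q (S j)) M). cbn [psum] in E2.
    assert (Q0 := HQ O). assert (Q1 := HQ 1%nat). assert (QM := HQ M).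
    assert (QSM := HQ (S M)).
    assert (W : 0 <= C1 ^ 2 * lv)
      by (apply Rmult_le_pos; [apply pow2_ge_0 | apply (sqnorm_pos _ _ Hv)]).
    lra. }
  apply Rle_plus_epsilon. intros eps He.
  destruct (block_max_l2_vanish u lu eps Hu He) as [N0 HN].
  assert (SM := Sum (max N N0)). assert (QM := HN (S (max N N0)) ltac:(lia)).
  assert (Mo := psum_mono (fun j => Q (S j)) N (max N N0) ltac:(intro; apply HQ) ltac:(lia)).
  unfold Q in *. lra.
Qed.

(** The zeroth block remains to be bounded by [w], the norm of [(J - x) u]. Up to [G w], [u] equals
    [u 0] times the polynomials on the blocks up to [J]. There the polynomials gain at least 1 over
    block 0, whereas [block_max_l2_sum] allows [u] to gain only a multiple of [w]; hence
    [|u 0| <= E w]. *)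
Lemma growth_resolvent (Hg : forall B, exists j, B <= block_max (jac_Z b x) P j) :
  in_resolvent b x.
Proof.
  set (p := jac_Z b x) in *.
  assert (Hp : recurrence c x p (fun _ => 0)) by (apply jac_Z_recurrence; exact Hbc).
  destruct (Hg (block_max p P 0 + 1)) as [J HJ].
  assert (J0 : J <> O) by (intros ->; lra).
  set (G := 7 ^ (S J * P)). set (E := 2 * G + 4 * C1).
  set (F := E * block_max p P 0 + G).
  assert (G0 : 0 <= G) by (apply pow_le; lra).
  assert (V0p := bmax_pos (fun d => norm2 p (Z.of_nat (0 * P + d))) P).
  fold (block_max p P 0) in V0p.
  assert (HE : 0 <= E) by (unfold E; lra).
  assert (HF : 0 <= F) by (unfold F; assert (0 <= E * block_max p P 0)
    by (apply Rmult_le_pos; lra); lra).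
  apply bounded_below_resolvent
    with (D := 5) (C := INR P * (102 / 100 * F ^ 2 + 13 * C1 ^ 2) + 1).
  { intro k. rewrite Hbc, Rabs_minus_sym. apply Hx. }
  { assert (A := pos_INR P). assert (B := pow2_ge_0 F). assert (B' := pow2_ge_0 C1).
    assert (0 <= INR P * (102 / 100 * F ^ 2 + 13 * C1 ^ 2)) by (apply Rmult_le_pos; lra).
    lra. }
  intros u lu lv _ Hu Hv.
  assert (lv0 := sqnorm_pos _ _ Hv).
  set (w := sqrt lv). assert (w0 : 0 <= w) by apply sqrt_pos.
  assert (w2 : w ^ 2 = lv) by (unfold w; rewrite <- Rsqr_pow2; apply Rsqr_sqrt; exact lv0).
  set (U := extend u).
  pose (dif := fun z => U z - u O * p z).
  assert (Hdif : recurrence c x dif (fun z => extend (shifted b x u) (z - 1))).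
  { intros n Hn. unfold dif. rewrite (Hp n Hn).
    unfold U. rewrite (extend_recurrence u n Hn). ring. }
  assert (D0 : norm2 dif 0 = 0).
  { unfold norm2, dif, U. rewrite (extend_neg u (0 - 1)) by lia.
    change 0%Z with (Z.of_nat 0). rewrite extend_nat. unfold p. rewrite jac_Z_nat.
    unfold jac_Z, extend, jac_p; cbn. rewrite !Rmult_0_r, Rmult_1_r, !Rminus_diag, Rabs_R0. ring. }
  assert (Db : forall m, (m < S J * P)%nat -> norm2 dif (Z.of_nat m) <= G * w).
  { intros m Hm. apply Rle_trans with (7 ^ m * w).
    - apply (perturbation_bound dif _ w m Hdif w0); [|exact D0].
      intro i. apply extend_sqr_le, Hv.
    - apply Rmult_le_compat_r; [exact w0|]. apply Rle_pow; [lra|lia]. }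
  assert (Tri : forall m, norm2 U m <= Rabs (u O) * norm2 p m + norm2 dif m
                       /\ Rabs (u O) * norm2 p m <= norm2 U m + norm2 dif m).
  { intro m. unfold norm2. rewrite Rmult_plus_distr_l, <- !Rabs_mult.
    assert (A1 := Rabs_comb3 (U m) (u O * p m) (dif m) 0 ltac:(unfold dif; ring)).
    assert (A2 := Rabs_comb3 (U (m - 1)%Z) (u O * p (m - 1)%Z) (dif (m - 1)%Z) 0
      ltac:(unfold dif; ring)).
    assert (A3 := Rabs_comb3 (u O * p m) (U m) (- dif m) 0 ltac:(unfold dif; ring)).
    assert (A4 := Rabs_comb3 (u O * p (m - 1)%Z) (U (m - 1)%Z) (- dif (m - 1)%Z) 0
      ltac:(unfold dif; ring)).
    rewrite Rabs_Ropp in A3, A4. rewrite Rabs_R0 in *. lra. }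
  assert (Gw : 0 <= G * w) by (apply Rmult_le_pos; assumption).
  assert (VJ : Rabs (u O) * block_max p P J <= block_max U P J + G * w).
  { assert (VU := bmax_pos (fun d => norm2 U (Z.of_nat (J * P + d))) P).
    apply bmax_scale; [apply Rabs_pos | fold (block_max U P J) in VU; lra |].
    intros d Hd. assert (T := proj2 (Tri (Z.of_nat (J * P + d)))).
    assert (T1 := Db (J * P + d)%nat ltac:(lia)).
    assert (T2 := block_max_ge U P J (Z.of_nat (J * P + d)) ltac:(lia)). lra. }
  assert (V0 : block_max U P 0 <= Rabs (u O) * block_max p P 0 + G * w).
  { apply bmax_le.
    - assert (0 <= Rabs (u O) * block_max p P 0)
        by (apply Rmult_le_pos; [apply Rabs_pos | exact V0p]). lra.
    - intros d Hd. assert (T := proj1 (Tri (Z.of_nat (0 * P + d)))).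
      assert (T1 := Db (0 * P + d)%nat ltac:(lia)).
      assert (T2 := block_max_ge p P 0 (Z.of_nat (0 * P + d)) ltac:(lia)).
      apply (Rmult_le_compat_l (Rabs (u O))) in T2; [|apply Rabs_pos]. lra. }
  assert (Sum := fun N => block_max_l2_sum u lu lv N Hu Hv). fold U in Sum.
  assert (VU0 := bmax_pos (fun d => norm2 U (Z.of_nat (0 * P + d))) P).
  fold (block_max U P 0) in VU0.
  assert (C1w : 0 <= C1 * w) by (apply Rmult_le_pos; assumption).
  (* One term of the sum suffices, and [13 <= 4 ^ 2] allows the square root to be taken. *)
  assert (QJ : block_max U P J <= block_max U P 0 + 4 * (C1 * w)).
  { apply Rsqr_incr_0_var; [|lra]. rewrite !Rsqr_pow2.
    assert (SJ := Sum J).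
    assert (T := psum_term (fun j => block_max U P (S j) ^ 2) 0 J (J - 1)
      ltac:(intro; apply pow2_ge_0) ltac:(lia)).
    cbn beta in T. replace (S (J - 1)) with J in T by lia. cbn [psum] in T.
    assert (W : (block_max U P 0 + 4 * (C1 * w)) ^ 2
      = block_max U P 0 ^ 2 + 16 * (C1 ^ 2 * lv) + 8 * (block_max U P 0 * (C1 * w)))
      by (rewrite <- w2; ring).
    assert (X1 : 0 <= block_max U P 0 * (C1 * w)) by (apply Rmult_le_pos; assumption).
    assert (X2 : 0 <= C1 ^ 2 * lv) by (apply Rmult_le_pos; [apply pow2_ge_0 | exact lv0]).
    assert (X3 := pow2_ge_0 (block_max U P 0)). lra. }
  assert (U0 : Rabs (u O) <= E * w).
  { assert (M : Rabs (u O) * (block_max p P 0 + 1) <= Rabs (u O) * block_max p P J)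
      by (apply Rmult_le_compat_l; [apply Rabs_pos | exact HJ]).
    unfold E. lra. }
  assert (VF : block_max U P 0 <= F * w).
  { assert (M : Rabs (u O) * block_max p P 0 <= E * w * block_max p P 0)
      by (apply Rmult_le_compat_r; assumption).
    unfold F. lra. }
  assert (VF2 : block_max U P 0 ^ 2 <= F ^ 2 * lv).
  { rewrite <- w2, <- Rpow_mult_distr. apply pow_incr. split; assumption. }
  apply sqnorm_le with (1 := Hu). intro r.
  apply Rle_trans with (psum (fun k => u k ^ 2) (S r * P)).
  { apply psum_mono; [intro; apply pow2_ge_0 | nia]. }
  rewrite <- psum_blocks.
  apply Rle_trans with (psum (fun j => INR P * block_max U P j ^ 2 + 0 * 0) (S r)).
  { apply psum_le. intros j _.
    apply Rle_trans with (psum (fun _ => block_max U P j ^ 2) P).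
    - apply psum_le. intros d Hd. rewrite <- (pow2_abs (u (j * P + d)%nat)).
      apply pow_incr. split; [apply Rabs_pos|].
      assert (T := block_max_ge U P j (Z.of_nat (j * P + d)) ltac:(lia)).
      unfold norm2 in T. unfold U in T at 1. rewrite extend_nat in T.
      assert (A := Rabs_pos (U (Z.of_nat (j * P + d) - 1)%Z)). lra.
    - apply Req_le. rewrite Rmult_0_l, Rplus_0_r. generalize (block_max U P j ^ 2).
      intro y. clear. induction P as [|n IH]; [cbn; ring|].
      rewrite S_INR. cbn [psum]. rewrite IH. ring. }
  rewrite (psum_lin _ (fun _ => 0)), Rmult_0_l, Rplus_0_r, psum_head.
  assert (Sr := Sum r).
  apply Rle_trans with (INR P * (102 / 100 * F ^ 2 + 13 * C1 ^ 2) * lv); [|lra].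
  rewrite Rmult_assoc. apply Rmult_le_compat_l; [apply pos_INR|]. lra.
Qed.

End Growth.

(** * Conclusion *)

Lemma fib_letter_bounds (theta : R) (n : Z) : 0 <= fib_letter theta n <= 1.
Proof.
  replace n with (n - 1 + 1)%Z by lia. rewrite (tp_0 _ (fib_hierarchy theta)).
  destruct (tp (fib_hierarchy theta) 0 (n - 1)%Z); lra.
Qed.

Lemma jac_K_ge_1 (b : nat -> R) (n : nat) (x : R) : 1 <= jac_K b n x x.
Proof.
  unfold jac_K. rewrite psum_sum_f_R0, psum_head.
  assert (P := psum_pos (fun d => jac_p b (S d) x * jac_p b (S d) x) n ltac:(intro; nra)).
  unfold jac_p at 1 2. cbn. lra.
Qed.

Lemma ratio_bounded_traces (theta x : R) (M n : nat) : Rabs x <= 4 -> (0 < M)%nat ->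
  (forall j, (j <= 6 * M)%nat -> Rabs (long_trace x j) <= 200) ->
  (long_len (6 * M + 2) <= n)%nat ->
  jac_p (fib_b theta) n x ^ 2 / jac_K (fib_b theta) n x x <= 201 ^ 2 * 4 / INR M.
Proof.
  intros Hx HM HX Hn. set (b := fib_b theta).
  assert (Hxc : forall i, Rabs (x - fib_letter theta i) <= 5).
  { intro i. assert (F := fib_letter_bounds theta i).
    apply Rabs_le_iff in Hx. apply Rabs_le_iff. lra. }
  assert (Hu := jac_Z_recurrence b (fib_letter theta) x (fib_b_letter theta)).
  assert (A := bounded_traces_count (fib_hierarchy theta) x Hxc _ Hu M n HX
    ltac:(rewrite <- long_len_Z; lia)).
  assert (B := jac_K_ge b x n _ Hn). assert (K1 := jac_K_ge_1 b n x).
  assert (M0 : 0 < INR M) by (apply lt_0_INR; exact HM).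
  assert (C : jac_p b n x ^ 2 <= norm2 (jac_Z b x) (Z.of_nat n) ^ 2).
  { rewrite <- (pow2_abs (jac_p b n x)). apply pow_incr. split; [apply Rabs_pos|].
    unfold norm2. rewrite jac_Z_nat.
    assert (R0 := Rabs_pos (jac_Z b x (Z.of_nat n - 1)%Z)). lra. }
  apply (Rmult_le_compat_l (INR M)) in C; [|lra].
  apply Rle_div_l; [lra|].
  replace (201 ^ 2 * 4 / INR M * jac_K b n x x)
    with (201 ^ 2 * 4 * jac_K b n x x / INR M) by (field; lra).
  apply (Rle_div_r _ _ (INR M)); [exact M0|]. lra.
Qed.

(** Growth would put [x] in the resolvent set, so decay remains. Its starting value, the maximum
    over block 0, is at most [6 ^ P] for all these energies. *)
Lemma escaping_decay (theta x : R) (k n : nat) : Rabs x <= 4 ->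
  in_spectrum (fib_b theta) x ->
  200 <= Rabs (long_trace x (S (S k))) -> 200 <= Rabs (long_trace x (S (S (S k)))) ->
  let P := (long_len (S (S (S k))) + 2)%nat in
  Rabs (jac_p (fib_b theta) n x) <= (1 / 2) ^ (n / P) * 6 ^ P.
Proof.
  intros Hx Hsp T1 T2 P. set (b := fib_b theta) in *.
  assert (Hxc : forall i, Rabs (x - fib_letter theta i) <= 5).
  { intro i. assert (F := fib_letter_bounds theta i).
    apply Rabs_le_iff in Hx. apply Rabs_le_iff. lra. }
  assert (Hu := jac_Z_recurrence b (fib_letter theta) x (fib_b_letter theta)).
  set (p := jac_Z b x) in *.
  destruct (block_max_contract (fib_hierarchy theta) x (S (S k)) Hxc (short_length_ge_2 k)
    T1 T2) as [C [HC Hc]]. fold P in Hc. cbv zeta in Hc.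
  assert (HP : (0 < P)%nat) by (unfold P; lia).
  destruct (decay_or_growth (block_max p P)) as [Dec|Gro].
  - intro j. apply bmax_pos.
  - intro j. assert (H := Hc p (fun _ => 0) Hu j 0 (Rle_refl 0)
      ltac:(intros; cbv beta; rewrite Rabs_R0; lra)). lra.
  - assert (Init : forall m, norm2 p (Z.of_nat m) <= 6 ^ m).
    { induction m as [|m IH].
      - unfold norm2, p, jac_Z, jac_p; cbn. rewrite Rabs_R0, Rabs_R1. lra.
      - assert (S1 := proj1 (norm2_step x Hxc p _ Hu (Z.of_nat m) ltac:(lia))).
        replace (Z.of_nat m + 1)%Z with (Z.of_nat (S m)) in S1 by lia.
        rewrite Rabs_R0 in S1. cbn [pow]. lra. }
    assert (V0 : block_max p P 0 <= 6 ^ P).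
    { apply bmax_le; [apply pow_le; lra|]. intros d Hd.
      apply Rle_trans with (1 := Init (0 * P + d)%nat). apply Rle_pow; [lra|lia]. }
    assert (A : Rabs (jac_p b n x) <= norm2 p (Z.of_nat n)).
    { unfold norm2, p. rewrite jac_Z_nat.
      assert (R0 := Rabs_pos (jac_Z b x (Z.of_nat n - 1)%Z)). lra. }
    assert (Dm := Nat.div_mod_eq n P). assert (Mb := Nat.mod_upper_bound n P ltac:(lia)).
    assert (B := block_max_ge p P (n / P) (Z.of_nat n) ltac:(lia)).
    assert (D := Dec (n / P)%nat).
    assert (E : (1 / 2) ^ (n / P) * block_max p P 0 <= (1 / 2) ^ (n / P) * 6 ^ P)
      by (apply Rmult_le_compat_l; [apply pow_le; lra | exact V0]).
    lra.
  - exfalso. apply Hsp.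
    exact (growth_resolvent b (fib_b_letter theta) x Hxc P HP C HC Hc Gro).
Qed.

Theorem theorem8p3 (theta : R) (Htheta : 0 <= theta < 1) :
  forall eps : R, eps > 0 ->
  exists N : nat, forall n : nat, (n >= N)%nat ->
    forall x0 : R, in_spectrum (fib_b theta) x0 ->
      (jac_p (fib_b theta) n x0) ^ 2 / jac_K (fib_b theta) n x0 x0 <= eps.
Proof.
  intros eps He.
  destruct (INR_unbounded (201 ^ 2 * 4 / eps)) as [M HM].
  assert (M0 : 0 < INR M)
    by (assert (0 < 201 ^ 2 * 4 / eps) by (apply Rdiv_lt_0_compat; lra); lra).
  assert (M1 : (0 < M)%nat) by (apply INR_lt; exact M0).
  (* [M] is fixed by [eps] through the bounded case, and [P] by [M]; the decay rate is thus the same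
     for all energies in the escaping case. *)
  pose (P := (long_len (S (S (S (6 * M)))) + 2)%nat).
  assert (P0 : 0 < 6 ^ P) by (apply pow_lt; lra).
  (* This makes [|p_n| <= Rmin 1 eps]; the cap at 1 then gives [p_n^2 <= eps]. *)
  pose (d := Rmin 1 eps / 6 ^ P).
  assert (Hmin : 0 < Rmin 1 eps) by (apply Rmin_glb_lt; lra).
  destruct (pow_lt_1_zero (1 / 2) ltac:(rewrite Rabs_right; lra) d
    ltac:(apply Rdiv_lt_0_compat; assumption)) as [J HJ].
  exists (max (long_len (6 * M + 2)) (J * P)). intros n Hn x Hsp.
  assert (Hx : Rabs x <= 4).
  { apply Rnot_lt_le. intro L. apply Hsp. apply large_energy_resolvent; [|exact L].
    intro k. rewrite fib_b_letter. apply fib_letter_bounds. }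
  destruct (trace_dichotomy x (6 * M) Hx) as [T|T].
  - apply Rle_trans with (201 ^ 2 * 4 / INR M).
    + apply ratio_bounded_traces; trivial. lia.
    + apply Rle_div_l; [exact M0|]. apply Rlt_le.
      apply Rlt_div_l in HM; [|exact He]. lra.
  - assert (A := escaping_decay theta x (6 * M) n Hx Hsp
      ltac:(apply T; lia) ltac:(apply T; lia)). cbv zeta in A. fold P in A.
    assert (B := HJ (n / P)%nat ltac:(apply Nat.div_le_lower_bound; unfold P in *; lia)).
    rewrite Rabs_right in B by (apply Rle_ge, pow_le; lra).
    assert (C : (1 / 2) ^ (n / P) * 6 ^ P <= Rmin 1 eps).
    { replace (Rmin 1 eps) with (d * 6 ^ P) by (unfold d; field; lra).
      apply Rmult_le_compat_r; lra. }
    assert (K1 := jac_K_ge_1 (fib_b theta) n x).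
    set (q := jac_p (fib_b theta) n x) in *.
    assert (Q : q ^ 2 <= Rmin 1 eps * Rmin 1 eps).
    { rewrite <- pow2_abs. cbn [pow]. rewrite Rmult_1_r.
      apply Rmult_le_compat; try apply Rabs_pos; lra. }
    assert (L1 := Rmin_l 1 eps). assert (L2 := Rmin_r 1 eps).
    assert (L3 : Rmin 1 eps * Rmin 1 eps <= 1 * eps) by (apply Rmult_le_compat; lra).
    apply Rle_div_l; [lra|].
    assert (eps * 1 <= eps * jac_K (fib_b theta) n x x) by (apply Rmult_le_compat_l; lra).
    lra.
Qed.
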